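(* Let Assumption A (on $\theta$) and Assumption B (on the spaces and the operators $F_i$), stated in the context, hold. Assume that $\mu_0>0$ and $\tau>1$ are chosen such that $$c_0 := 1-\eta-\frac{1+\eta}{\tau}-\frac{p-1}{p}\left(\frac{\mu_0}{2\sigma}\right)^{\frac{1}{p-1}}>0 .$$ Let $\{(\xi_n^\delta,x_n^\delta)\}_{n\ge0}$ be the iterates of the SGD-$\theta$ method with noisy data (defined in the context), and assume that the (a priori chosen) integer stopping index $n_\delta$ satisfies $n_\delta\to\infty$ as $\delta\to0$. Then there exists a solution $x^*\in B_{2\rho}(x_0)\cap\mathscr D(\theta)$ of the system $F_i(x)=y_i$, $i=1,\dots,N$, such that $$\lim_{\delta\to0}\mathbb E\left[\|x_{n_\delta}^\delta-x^*\|^p\right]=0\quad\text{and}\quad\lim_{\delta\to0}\mathbb E\left[D_{\xi_{n_\delta}^\delta}\theta(x^*,x_{n_\delta}^\delta)\right]=0 .$$ Further, if $\mathcal N(F_i'(x^\dag))\subset\mathcal N(F_i'(x))$ for all $x\in B_{2\rho}(x_0)$ and $i=1,\dots,N$, then $x^*=x^\dag$.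
   Context: **Problem.** $\mathcal X$ and $\mathcal Y_1,\dots,\mathcal Y_N$ are Banach spaces, $F_i:\mathscr D(F_i)\subset\mathcal X\to\mathcal Y_i$ are (linear or nonlinear) operators, $\mathcal D:=\bigcap_{i=1}^N\mathscr D(F_i)\neq\emptyset$, and $y_i\in\mathcal Y_i$ are exact data such that the system $F_i(x)=y_i$, $i=1,\dots,N$, has a solution (possibly not unique). Noisy data $y^\delta=(y_1^\delta,\dots,y_N^\delta)$ satisfy $\|y_i^\delta-y_i\|\le\delta_i$ with $\delta_i>0$, and $\delta:=(\delta_1^r+\dots+\delta_N^r)^{1/r}$ with $r$ as below. $B_s(x_0)=\{x\in\mathcal X:\|x-x_0\|\le s\}$; $\mathcal N(A)$ is the null space of $A$. **Convex analysis.** For convex $\theta:\mathcal X\to(-\infty,\infty]$: $\mathscr D(\theta)=\{x:\theta(x)<\infty\}$, $\partial\theta(x)$ is the subdifferential, $\mathscr D(\partial\theta)=\{x\in\mathscr D(\theta):\partial\theta(x)\ne\emptyset\}$, and for $\xi\in\partial\theta(x)$ the Bregman distance is $D_\xi\theta(\bar x,x)=\theta(\bar x)-\theta(x)-\langle\xi,\bar x-x\rangle$. A proper $\theta$ is $p$-convex ($p\ge2$) if for some $\sigma>0$, $\theta(tx+(1-t)\bar x)+\sigma t(1-t)\|x-\bar x\|^p\le t\theta(x)+(1-t)\theta(\bar x)$ for all $x,\bar x\in\mathcal X$, $t\in[0,1]$. Fix $x_0\in\mathscr D(\partial\theta)$ and $\xi_0\in\partial\theta(x_0)$. **Assumption A.**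 $\theta:\mathcal X\to(-\infty,\infty]$ is proper, lower semi-continuous and $p$-convex with $p\ge2$, and $\sigma>0$ is a constant with $D_\xi\theta(\bar x,x)\ge\sigma\|\bar x-x\|^p$ for all $\bar x\in\mathcal X$, $x\in\mathscr D(\partial\theta)$, $\xi\in\partial\theta(x)$. **Assumption B.** (a) $\mathcal X$ is reflexive and each $\mathcal Y_i$ is uniformly smooth. (b) There is $\rho>0$ with $B_{2\rho}(x_0)\subset\mathcal D$ and the system has a solution $x_*\in\mathscr D(\theta)$ with $D_{\xi_0}\theta(x_*,x_0)\le\sigma\rho^p$. (c) Each $F_i$ is weakly closed on $\mathcal D$: if $x_n\in\mathcal D$, $x_n\rightharpoonup x$ in $\mathcal X$ and $F_i(x_n)\rightharpoonup v_i$ in $\mathcal Y_i$, then $x\in\mathcal D$ and $F_i(x)=v_i$. (d) Each $F_i$ is Fréchet differentiable on $\mathcal D$, $x\mapsto F_i'(x)$ is continuous on $B_{2\rho}(x_0)$, there is $B_0>0$ with $\|F_i'(x)\|\le B_0$ for all $x\in B_{2\rho}(x_0)$ and all $i$, and there is $0\le\eta<1$ such that $\|F_i(x)-F_i(\bar x)-F_i'(\bar x)(x-\bar x)\|\le\eta\|F_i(x)-F_i(\bar x)\|$ for all $x,\bar x\in B_{2\rho}(x_0)$ and all $i$. **The solution $x^\dag$.** $x^\dag$ denotes the solution of the system in $\mathscr D(\theta)\cap\mathcal D$ minimizing $x\mapsto D_{\xi_0}\theta(x,x_0)$ among all solutions in $\mathscr D(\theta)\cap\mathcal D$; under Assumptions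 A and B it is uniquely defined. **SGD-$\theta$ method with noisy data.** Let $1<r<\infty$ and let $J_r^{\mathcal Y_i}:\mathcal Y_i\to\mathcal Y_i^*$ be the (single-valued) duality mapping: $\|J_r^{\mathcal Y_i}(y)\|=\|y\|^{r-1}$, $\langle J_r^{\mathcal Y_i}(y),y\rangle=\|y\|^r$. Let $i_0,i_1,\dots$ be independent random indices uniformly distributed on $\{1,\dots,N\}$, on the probability space $(\Omega,\mathcal F,\mathbb P)$ with $\Omega=\{1,\dots,N\}^\infty$; $\mathbb E$ is the expectation. Set $x_0^\delta=x_0$, $\xi_0^\delta=\xi_0$, and for $n\ge0$, with $r_n^\delta:=F_{i_n}(x_n^\delta)-y_{i_n}^\delta$, $$\xi_{n+1}^\delta=\xi_n^\delta-t_n^\delta F_{i_n}'(x_n^\delta)^*J_r^{\mathcal Y_{i_n}}(r_n^\delta),\qquad x_{n+1}^\delta=\arg\min_{x\in\mathcal X}\{\theta(x)-\langle\xi_{n+1}^\delta,x\rangle\},$$ where $t_n^\delta=\tilde t_n^\delta\|r_n^\delta\|^{p-r}$ if $\|r_n^\delta\|>\tau\delta_{i_n}$ and $t_n^\delta=0$ otherwise, with $$\tilde t_n^\delta=\min\left\{\frac{\mu_0\|r_n^\delta\|^{p(r-1)}}{\|F_{i_n}'(x_n^\delta)^*J_r^{\mathcal Y_{i_n}}(r_n^\delta)\|^p},\ \mu_1\right\}$$ for positive constants $\mu_0,\mu_1$ (the minimum is $\mu_1$ if the denominator vanishes). Under the hypotheses of the claim all $x_n^\delta$ lie in $B_{2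\rho}(x_0)$.
   Formalization: The solution x* is a random variable (Borel measurable, a solution in the ball and in D(θ) for every sample) rather than a fixed point of X, since the limit can depend on the drawn indices; under the null space condition x* = x† for every sample. *)

(* Defs.v *)
From HB Require Import structures.
From mathcomp Require Import all_boot all_order all_algebra.
From mathcomp Require Import all_classical all_reals all_analysis.

Set Implicit Arguments.
Unset Strict Implicit.
Unset Printing Implicit Defensive.

Import Order.TTheory GRing.Theory Num.Theory.
Import numFieldNormedType.Exports.

Local Open Scope classical_set_scope.
Local Open Scope ring_scope.

Section BanachSpaces.
Context {R : realType}.

Definition bounded_operator (V W : normedModType R) (A : V -> W) : Prop :=
  linear A /\ continuous A.

(* The topological dual, as a set of functions: the library has no type of
   continuous linear functionals. *)
Definition dual (V : normedModType R) : set (V -> R) :=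
  [set f | bounded_operator (f : V -> R^o)].

(* Meaningful for bounded operators only: [sup] is 0 on unbounded sets. *)
Definition opnorm (V W : normedModType R) (A : V -> W) : R :=
  sup [set `|A x| | x in [set x | `|x| <= 1]].

Definition dual_norm (V : normedModType R) (f : V -> R) : R :=
  opnorm (f : V -> R^o).

Definition adjoint (V W : normedModType R) (A : V -> W) (g : W -> R) : V -> R :=
  g \o A.

Definition nullspace (V W : normedModType R) (A : V -> W) : set V :=
  [set h | A h = 0].

Definition weakly_cvg (V : normedModType R) (u : nat -> V) (l : V) : Prop :=
  forall f, dual f -> (f \o u) @ \oo --> f l.

(* Surjectivity of the canonical embedding into the bidual; [phi] is only
   constrained, and only compared with evaluation, on [dual V]. *)
Definition reflexive_space (V : normedModType R) : Prop :=
  forall phi : (V -> R) -> R,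
    (forall (a : R) (f g : V -> R), dual f -> dual g ->
       phi (fun v => a * f v + g v) = a * phi f + phi g) ->
    (exists C : R, forall f, dual f -> `|phi f| <= C * dual_norm f) ->
    exists v : V, forall f, dual f -> phi f = f v.

Definition smoothness_modulus (V : normedModType R) (t : R) : R :=
  sup [set s | exists v w : V, [/\ `|v| = 1, `|w| <= t &
                 s = (`|v + w| + `|v - w|) / 2 - 1]].

Definition uniformly_smooth (V : normedModType R) : Prop :=
  smoothness_modulus V t / t @[t --> 0^'+] --> (0 : R).

Definition duality_mapping (V : normedModType R) (r : R) (v : V) :
    set (V -> R) :=
  [set g | [/\ dual g, dual_norm g = `|v| `^ (r - 1) & g v = `|v| `^ r]].

(* Frechet differentiability relative to the domain [D], so that the values of
   [f] outside [D] play no role; see [frechet_withinP] for interior points. *)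
Definition frechet_within (V W : normedModType R) (D : set V) (f : V -> W)
    (x : V) (A : V -> W) : Prop :=
  bounded_operator A /\
  forall e : R, 0 < e -> \forall z \near within D (nbhs x),
    `|f z - f x - A (z - x)| <= e * `|z - x|.

End BanachSpaces.

Section ConvexAnalysis.
Context {R : realType} {X : normedModType R}.
Implicit Types (theta : X -> \bar R) (xi : X -> R) (x : X).

Definition eff_dom theta : set X := [set x | (theta x < +oo)%E].

Definition proper_function theta : Prop :=
  (forall x, theta x != -oo%E) /\ eff_dom theta !=set0.

Definition p_convex (p : R) theta : Prop :=
  exists2 s : R, 0 < s & forall x x' (t : R), 0 <= t <= 1 ->
    (theta (t *: x + (1 - t) *: x')%R
       + (s * t * (1 - t) * `|x - x'| `^ p)%:E
     <= t%:E * theta x + (1 - t)%:E * theta x')%E.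

Definition subdiff theta x : set (X -> R) :=
  [set xi | dual xi /\ forall x', (theta x + (xi (x' - x)%R)%:E <= theta x')%E].

Definition dom_subdiff theta : set X :=
  [set x | eff_dom theta x /\ subdiff theta x !=set0].

Definition bregman theta xi (x' x : X) : \bar R :=
  (theta x' - theta x - (xi (x' - x)%R)%:E)%E.

Definition is_argmin (f : X -> \bar R) x : Prop := forall z, (f x <= f z)%E.

End ConvexAnalysis.

Section System.
Context {R : realType} {N : nat} {X : normedModType R}
  {Y : 'I_N -> normedModType R}.
Variables (domF : 'I_N -> set X) (F : forall i, X -> Y i) (y : forall i, Y i).

Definition common_dom : set X := [set x | forall i, domF i x].

Definition solution : set X :=
  [set x | common_dom x /\ forall i, F i x = y i].

Definition weakly_closed (D : set X) (i : 'I_N) : Prop :=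
  forall (u : nat -> X) (x : X) (v : Y i), (forall n, D (u n)) ->
    weakly_cvg u x -> weakly_cvg (fun n => F i (u n)) v -> D x /\ F i x = v.

Definition bregman_minimal_solution (theta : X -> \bar R) (xi0 : X -> R)
    (x0 xd : X) : Prop :=
  [/\ solution xd, eff_dom theta xd &
      forall x, solution x -> eff_dom theta x ->
        (bregman theta xi0 xd x0 <= bregman theta xi0 x x0)%E].

End System.

Section Noise.
Context {R : realType} {N : nat}.

Definition noise_level (r : R) (d : 'I_N -> R) : R :=
  (\sum_(i < N) d i `^ r) `^ r^-1.

(* The filter "delta -> 0" on vectors of positive noise levels. *)
Definition noise_to0 (r : R) : set_system ('I_N -> R) :=
  filter_from [set e : R | 0 < e]
    (fun e => [set d | (forall i, 0 < d i) /\ noise_level r d < e]).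

End Noise.

Section Probability.
Context {d : measure_display} {T : measurableType d} {R : realType}
  (P : probability T R) {N : nat}.

(* 'I_N carries no measurable structure in the library, so measurability is
   stated on preimages of arbitrary subsets of 'I_N. *)
Definition iid_uniform (ind : nat -> T -> 'I_N) : Prop :=
  [/\ forall n (A : set 'I_N), measurable (ind n @^-1` A),
      forall n j, P (ind n @^-1` [set j]) = (N%:R^-1)%:E &
      forall (s : seq nat) (A : nat -> set 'I_N), uniq s ->
        P (\bigcap_(n in [set` s]) (ind n @^-1` A n))
        = (\prod_(n <- s) P (ind n @^-1` A n))%E].

Definition borel_measurable (X : topologicalType) (f : T -> X) : Prop :=
  forall U : set X, open U -> measurable (f @^-1` U).

End Probability.

Section SGD.
Context {R : realType} {N : nat} {X : normedModType R}
  {Y : 'I_N -> normedModType R}.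
Variables (F : forall i, X -> Y i) (dF : forall i, X -> X -> Y i)
  (J : forall i, Y i -> Y i -> R) (theta : X -> \bar R) (p r mu0 mu1 tau : R).

(* [J i res : Y i -> R] is the value of the duality mapping at the residual. *)
Definition sgd_direction (i : 'I_N) (x : X) (res : Y i) : X -> R :=
  adjoint (dF i x) (@J i res).

Definition sgd_scaling (i : 'I_N) (x : X) (res : Y i) : R :=
  let g := dual_norm (sgd_direction x res) in
  if g == 0 then mu1
  else Num.min (mu0 * `|res| `^ (p * (r - 1)) / g `^ p) mu1.

Definition sgd_step (di : R) (i : 'I_N) (x : X) (res : Y i) : R :=
  if tau * di < `|res| then sgd_scaling x res * `|res| `^ (p - r) else 0.

(* [d] is the vector of noise levels, [yd] the noisy data and [ind] the sequence
   of selected indices. *)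
Definition sgd_iterates (x0 : X) (xi0 : X -> R) (d : 'I_N -> R)
    (yd : forall i, Y i) (ind : nat -> 'I_N)
    (xi : nat -> X -> R) (x : nat -> X) : Prop :=
  [/\ x 0%N = x0, xi 0%N = xi0 &
      forall n, let i := ind n in let res := F i (x n) - yd i in
        xi n.+1 = (fun h => xi n h
                     - sgd_step (d i) (x n) res * sgd_direction (x n) res h)
        /\ is_argmin (fun z => theta z - (xi n.+1 z)%:E)%E (x n.+1)].

End SGD.

Lemma frechet_withinP {R : realType} (V W : normedModType R) (D : set V)
    (f : V -> W) (x : V) (A : V -> W) : nbhs x D ->
  frechet_within D f x A <-> differentiable f x /\ 'd f x = A :> (V -> W).
Proof.
move=> xD; split.
- move=> [[linA contA] fA].
  pose B : {linear V -> W} :=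
    HB.pack_for {linear V -> W} A (GRing.isLinear.Build _ _ _ _ _ linA).
  have fE : f \o shift x = cst (f x) + (B : V -> W) +o_ 0 id.
    apply/eqaddoP => e e0; have {}fA := fA _ e0.
    have {fA} : \forall z \near x, `|f z - f x - A (z - x)| <= e * `|z - x|.
      by move: fA; rewrite !near_withinE; apply: filter_app; near=> z; apply;
        near: z.
    rewrite (near_shift 0) subr0; apply: filterS => h /=.
    by rewrite addrK opprD addrA.
  have dE : 'd f x = B :> (V -> W) by exact: diff_unique.
  split; last exact: dE.
  apply/diff_locallyP; split; first by rewrite dE.
  by rewrite dE.
- move=> [df <-]; split; first by split; [exact: linearP|exact: diff_continuous].
  move=> e e0; have /eqaddoP/(_ _ e0) := diff_locally df.
  rewrite near_withinE [X in _ -> X](near_shift 0) subr0.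
  apply: filterS => h /= + _.
  by rewrite addrK opprD addrA.
Unshelve. all: by end_near.
Qed.

(* Main.v *)
Require Import Defs.
From HB Require Import structures.
From mathcomp Require Import all_boot all_order all_algebra.
From mathcomp Require Import all_classical all_reals all_analysis.
From mathcomp Require Import measurable_realfun.
From mathcomp Require Import ring lra.

Set Implicit Arguments.
Unset Strict Implicit.
Unset Printing Implicit Defensive.

Import Order.TTheory GRing.Theory Num.Theory.
Import numFieldNormedType.Exports.

Local Open Scope classical_set_scope.
Local Open Scope ring_scope.

(** Bregman distances to a solution decrease along every sequence of indices, for
    noisy and for exact data, by at least a multiple of |residual|^p. For exact data,
    averaging over the next index shows that the total residuals
    sum_i |F_i(x_n) - y_i|^p have a summable expectation. Along a path where they are
    summable, the iterates whose total residual is the lowest so far form a Cauchy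
    sequence; the Bregman distances of all iterates to its limit x* are bounded by
    the tails of a convergent series, whose expectations tend to 0. For noisy data,
    the n-th iterate takes finitely many values, one for each word of n indices, and
    for each word it tends to the exact one as delta -> 0. Hence the noisy Bregman
    distance to x* at a fixed step n is eventually close to the exact one, uniformly
    over the paths, and by monotonicity it bounds the one at step n_delta >= n. *)

(** * Bounded operators and dual norms *)

(** The Cauchy estimate tests the update made at step m, which involves only equation i_m, against a
    later iterate x_k, so it needs the residual of x_k in equation i_m. The decrease along a path
    controls only the residual of the equation drawn at each step and gives no hold on this one. At
    a record low the total residual of x_k is at most that of x_m, which suffices; the price is
    summability of the total residuals, which comes from an expectation and hence holds only almost
    surely. The limit x* depends on the whole infinite path, so it cannot be fixed beforehand. The
    one-step decrease and the stability estimate therefore hold for all solutions in the ball at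
    once, and x* is inserted once the path is known. In c0, the part 1 - eta - (1 + eta) / tau comes
    from the tangential cone condition and the switch |residual| > tau * delta_i; the remaining term
    is the price of Young's inequality, by which p-convexity absorbs the displacement of the iterate
    in one step. *)

Section BoundedOperators.
Context {R : realType} {V W : normedModType R}.
Implicit Types A B : V -> W.

Lemma bounded_operatorP A : linear A ->
  bounded_operator A <-> exists C, forall h, `|A h| <= C * `|h|.
Proof.
move=> linA.
pose L : {linear V -> W} :=
  HB.pack_for {linear V -> W} A (GRing.isLinear.Build _ _ _ _ _ linA).
split=> [[_ cA]|[C AC]].
- have /linear_boundedP[M [_ MP]] : bounded_near L (nbhs 0).
    exact/linear_bounded_continuous.
  by exists (M + 1) => h; apply: MP; rewrite ltrDl.
- split=> //; apply: (@bounded_linear_continuous _ _ _ L).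
  apply/linear_boundedP; exists C; split; first exact: num_real.
  move=> r Cr h; apply: (le_trans (AC h)).
  by rewrite ler_wpM2r// ltW.
Qed.

Lemma bounded_op0 A : bounded_operator A -> A 0 = 0.
Proof. by move=> [lA _]; have := lA (-1) 0 0; rewrite scaler0 addr0 scaleN1r addNr. Qed.

Lemma bounded_opZ A a h : bounded_operator A -> A (a *: h) = a *: A h.
Proof. by move=> bA; have [lA _] := bA; have := lA a h 0; rewrite (bounded_op0 bA) !addr0. Qed.

Lemma bounded_opB A u v : bounded_operator A -> A (u - v) = A u - A v.
Proof. by move=> [lA _]; rewrite addrC -scaleN1r lA scaleN1r addrC. Qed.

Lemma opnorm_has_sup A : bounded_operator A ->
  has_sup [set `|A x| | x in [set x | `|x| <= 1]].
Proof.
move=> bA; have [linA _] := bA.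
have [C AC] := (bounded_operatorP linA).1 bA.
split.
  by exists `|A 0|, 0 => //=; rewrite normr0.
exists `|C| => _ [h /= h1 <-]; apply: (le_trans (AC h)).
apply: (le_trans (ler_norm _)); rewrite normrM normr_id.
by rewrite ler_piMr.
Qed.

Lemma le_opnorm A h : bounded_operator A -> `|A h| <= opnorm A * `|h|.
Proof.
move=> bA; have A0 := bounded_op0 bA.
have [->|h0] := eqVneq h 0; first by rewrite A0 !normr0 mulr0.
have nh : 0 < `|h| by rewrite normr_gt0.
have -> : `|A h| = `|A (`|h|^-1 *: h)| * `|h|.
  by rewrite bounded_opZ// normrZ normfV normr_id mulrAC mulVf ?mul1r// gt_eqF.
rewrite ler_wpM2r//; apply: sup_upper_bound; first exact: opnorm_has_sup.
by exists (`|h|^-1 *: h) => //=; rewrite normrZ normfV normr_id mulVf// gt_eqF.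
Qed.

Lemma opnorm_ge0 A : bounded_operator A -> 0 <= opnorm A.
Proof.
move=> bA; apply: (@le_trans _ _ `|A 0|) => //.
apply: sup_upper_bound; first exact: opnorm_has_sup.
by exists 0 => //=; rewrite normr0.
Qed.

Lemma opnorm_le A C : 0 <= C -> (forall h, `|A h| <= C * `|h|) -> opnorm A <= C.
Proof.
move=> C0 AC; apply: ge_sup.
  by exists `|A 0|; exists 0 => //=; rewrite normr0.
move=> _ [h /= h1 <-]; apply: (le_trans (AC h)).
by rewrite ler_piMr.
Qed.

Lemma bounded_operatorB A B : bounded_operator A -> bounded_operator B ->
  bounded_operator (fun h => A h - B h).
Proof.
move=> [lA cA] [lB cB]; split.
  by move=> a u v; rewrite lA lB scalerBr opprD addrACA.
by move=> z; apply: cvgB; [exact: cA|exact: cB].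
Qed.

End BoundedOperators.

Section Dual.
Context {R : realType} {V : normedModType R}.
Implicit Types f g : V -> R.

Lemma dualD f u v : dual f -> f (u + v) = f u + f v.
Proof. by move=> [lf _]; have := lf 1 u v; rewrite !scale1r. Qed.

Lemma dualZ f a u : dual f -> f (a *: u) = a * f u.
Proof. exact: (@bounded_opZ R V R^o). Qed.

Lemma dualB f u v : dual f -> f (u - v) = f u - f v.
Proof. exact: (@bounded_opB R V R^o). Qed.

Lemma dual0 f : dual f -> f 0 = 0.
Proof. exact: (@bounded_op0 R V R^o). Qed.

Lemma dualN f u : dual f -> f (- u) = - f u.
Proof. by move=> df; rewrite -[- u]sub0r dualB// dual0// sub0r. Qed.

Lemma le_dual_norm f h : dual f -> `|f h| <= dual_norm f * `|h|.
Proof. exact: (@le_opnorm R V R^o). Qed.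

Lemma dual_norm_ge0 f : dual f -> 0 <= dual_norm f.
Proof. exact: (@opnorm_ge0 R V R^o). Qed.

Lemma dual_norm_le f C : 0 <= C -> (forall h, `|f h| <= C * `|h|) -> dual_norm f <= C.
Proof. exact: (@opnorm_le R V R^o). Qed.

Lemma dual_comb f g a : dual f -> dual g -> dual (fun h => f h - a * g h).
Proof.
move=> df dg; have lin : linear ((fun h => f h - a * g h) : V -> R^o).
  move=> b u v; rewrite !dualD// !dualZ// /GRing.scale/=; ring.
apply/(bounded_operatorP lin); exists (dual_norm f + `|a| * dual_norm g) => h.
apply: (le_trans (ler_normB _ _)); rewrite mulrDl lerD//; first exact: le_dual_norm.
by rewrite normrM -mulrA ler_wpM2l//; exact: le_dual_norm.
Qed.

Lemma dual_sub f g : dual f -> dual g -> dual (fun h => f h - g h).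
Proof.
move=> df dg; have := dual_comb 1 df dg; congr dual.
by apply/funext => h; rewrite mul1r.
Qed.

Lemma dual_adjoint (U : normedModType R) (A : U -> V) f :
  bounded_operator A -> dual f -> dual (adjoint A f).
Proof.
move=> [lA cA] [lf cf]; split=> [a u v|z].
  by rewrite /adjoint /= lA lf.
by apply: (@continuous_comp _ _ _ A (f : V -> R^o)); [exact: cA|exact: cf].
Qed.

Lemma dual_norm_sub_le f g C : dual f -> dual g -> 0 <= C ->
  (forall h, `|f h - g h| <= C * `|h|) -> `|dual_norm f - dual_norm g| <= C.
Proof.
move=> df dg C0 fg; rewrite ler_distl; apply/andP; split.
  rewrite lerBlDr; apply: dual_norm_le; first by rewrite addr_ge0// dual_norm_ge0.
  move=> h; rewrite mulrDl -[g h](subrK (f h)) (le_trans (ler_normD _ _))//.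
  by rewrite addrC lerD//; [exact: le_dual_norm|rewrite distrC].
apply: dual_norm_le; first by rewrite addr_ge0// dual_norm_ge0.
move=> h; rewrite mulrDl -[f h](subrK (g h)) (le_trans (ler_normD _ _))//.
by rewrite addrC lerD//; exact: le_dual_norm.
Qed.

End Dual.

(** * Norm continuity of the duality mapping *)

Lemma cvg_powR {R : realType} {T : Type} (Fl : set_system T) {FFl : Filter Fl}
    (u : T -> R) (a s : R) :
  0 < a -> u @ Fl --> a -> u x `^ s @[x --> Fl] --> a `^ s.
Proof.
move=> a0 ua; apply: (@continuous_cvg _ _ _ Fl FFl u (fun z => z `^ s) a) => //.
apply/differentiable_continuous/derivable1_diffP/derivable_powR.
by rewrite in_itv/= andbT.
Qed.

(** Convergence in the dual norm, unfolded so that it makes sense for functions not yet known to be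
    in the dual. *)
Definition dual_cvg {R : realType} {V : normedModType R} {T : Type}
    (Fl : set_system T) (f_ : T -> V -> R) (f : V -> R) :=
  forall e : R, 0 < e -> \forall a \near Fl, forall h, `|f_ a h - f h| <= e * `|h|.

Section DualConvergence.
Context {R : realType} {V : normedModType R} {T : Type}.
Context (Fl : set_system T) {FFl : Filter Fl}.

Lemma dual_cvgZ (c_ : T -> R) (c : R) (f_ : T -> V -> R) (f : V -> R) :
  dual f -> c_ @ Fl --> c -> dual_cvg Fl f_ f ->
  dual_cvg Fl (fun a h => c_ a * f_ a h) (fun h => c * f h).
Proof.
move=> df cc ff e e0.
have N0 := dual_norm_ge0 df; set N := dual_norm f in N0 *.
pose e1 := e / 2 / (`|c| + 1); pose e2 := e / 2 / (N + 1).
have c1 : 0 < `|c| + 1 by rewrite ltr_wpDl.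
have N1 : 0 < N + 1 by rewrite ltr_wpDl.
have e20 : 0 < e / 2 by rewrite divr_gt0.
have e10 : 0 < e1 by rewrite divr_gt0.
have e2_gt0 : 0 < e2 by rewrite divr_gt0.
have [c_e c_1] : (\forall a \near Fl, `|c_ a - c| <= e2) /\
    \forall a \near Fl, `|c_ a - c| <= 1.
  by split; [move/cvgrPdistC_le: cc; exact|move/cvgrPdistC_le: cc; exact].
near=> a => h.
have -> : c_ a * f_ a h - c * f h = c_ a * (f_ a h - f h) + (c_ a - c) * f h by ring.
have -> : e * `|h| = e / 2 * `|h| + e / 2 * `|h| by field.
rewrite (le_trans (ler_normD _ _))// !normrM lerD//.
  have ca : `|c_ a| <= `|c| + 1.
    rewrite -[c_ a](subrK c) addrC (le_trans (ler_normD _ _))// lerD2l.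
    by near: a.
  have fa : `|f_ a h - f h| <= e1 * `|h| by move: h; near: a; exact: ff.
  apply: (le_trans (ler_pM _ _ ca fa)) => //.
  by rewrite mulrA mulrCA mulfV ?mulr1// gt_eqF.
have ca : `|c_ a - c| <= e2 by near: a.
apply: (le_trans (ler_pM _ _ ca (le_dual_norm h df))) => //.
rewrite -/N mulrA ler_wpM2r// /e2 mulrAC ler_pdivrMr// ler_wpM2l ?ltW//.
by rewrite ltr_pwDr.
Unshelve. all: by end_near.
Qed.

End DualConvergence.

Section UniformSmoothness.
Context {R : realType} {V : normedModType R}.

Lemma le_smoothness_modulus (t : R) (v w : V) : `|v| = 1 -> `|w| <= t ->
  `|v + w| + `|v - w| <= 2 + 2 * smoothness_modulus V t.
Proof.
move=> v1 wt; rewrite -lerBlDl -ler_pdivrMl// mulrBr mulVf// mulrC.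
apply: sup_upper_bound; last by exists v, w.
split; first by exists ((`|v + w| + `|v - w|) / 2 - 1), v, w.
exists t => _ [v' [w' [v'1 w't ->]]].
have := ler_normD v' w'; have := ler_normB v' w'; rewrite v'1.
lra.
Qed.

(** Uniform continuity of norming functionals on the unit sphere. Adding the bounds for
    [f (v + t *: k)], [g (v - t *: k)] and [g (w - v)] makes [g v] cancel and leaves twice the
    modulus at [t] plus [|v - w|]. *)
Lemma uniformly_smooth_dual (e : R) : uniformly_smooth V -> 0 < e ->
  exists2 eta, 0 < eta & forall v w (f g : V -> R),
    `|v| = 1 -> `|w| = 1 -> dual f -> dual g ->
    dual_norm f <= 1 -> dual_norm g <= 1 -> f v = 1 -> g w = 1 ->
    `|v - w| <= eta -> forall h, `|f h - g h| <= e * `|h|.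
Proof.
move=> smV e0.
(* The modulus is o(t), so [t] is fixed first; then [eta := t * e / 2] is the other half of the
   budget [t * e]. *)
have [t [t0 tP]] : exists t, 0 < t /\ 2 * smoothness_modulus V t <= t * e / 2.
  have e40 : 0 < e / 4 by rewrite divr_gt0.
  have /cvgrPdist_le/(_ _ e40) := smV.
  rewrite near_withinE near_nbhs => /nbhs_ballP[d /= d0 dP].
  exists (d / 2); have d20 : 0 < d / 2 by rewrite divr_gt0.
  have bd : ball (0 : R) d (d / 2).
    by rewrite /ball/= sub0r normrN gtr0_norm// ltr_pdivrMr// ltr_pMr// ltr1n.
  split=> //; have /= := dP (d / 2) bd d20.
  rewrite sub0r normrN => /(le_trans (ler_norm _)).
  rewrite ler_pdivrMr// => H; lra.
exists (t * e / 2); first by rewrite divr_gt0// mulr_gt0.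
move=> v w f g v1 w1 df dg f1 g1 fv gw vw.
(* [t (f - g)(k) <= |v + t k| + |v - t k| - 2 + |v - w|] *)
have main k : `|k| <= 1 -> f k - g k <= e.
  move=> k1; rewrite -(ler_pM2l t0).
  have tk : `|t *: k| <= t by rewrite normrZ gtr0_norm// ler_piMr// ltW.
  have := le_smoothness_modulus v1 tk.
  have fP : f (v + t *: k) <= `|v + t *: k|.
    apply: (le_trans (ler_norm _)); apply: (le_trans (le_dual_norm _ df)).
    by rewrite ler_piMl.
  have gP : g (v - t *: k) <= `|v - t *: k|.
    apply: (le_trans (ler_norm _)); apply: (le_trans (le_dual_norm _ dg)).
    by rewrite ler_piMl.
  have gvw : g (w - v) <= `|v - w|.
    rewrite distrC.
    apply: (le_trans (ler_norm _)); apply: (le_trans (le_dual_norm _ dg)).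
    by rewrite ler_piMl.
  move: fP gP gvw; rewrite (dualD _ _ df) !(dualB _ _ dg) (dualZ _ _ df)
    (dualZ _ _ dg) fv gw => fP gP gvw H.
  lra.
have mainN k : `|k| <= 1 -> `|f k - g k| <= e.
  move=> k1; rewrite ler_norml main// andbT.
  have := main (- k); rewrite normrN (dualN _ df) (dualN _ dg) => /(_ k1); lra.
move=> h; have [->|h0] := eqVneq h 0.
  by rewrite (dual0 df) (dual0 dg) subrr !normr0 mulr0.
have nh : 0 < `|h| by rewrite normr_gt0.
rewrite -ler_pdivrMr//.
have := mainN (`|h|^-1 *: h).
rewrite normrZ normfV normr_id mulVf ?gt_eqF// => /(_ (lexx _)).
by rewrite (dualZ _ _ df) (dualZ _ _ dg) -mulrBr normrM normfV normr_id mulrC.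
Qed.

(** Away from 0 the mapping factors as [|u| ^ (r - 1)] times [f u], a norming functional of the unit
    vector [u / |u|]. The scalar is continuous, and the functional is handled by uniform
    smoothness. *)
Lemma cvg_duality_mapping {T : Type} (Fl : set_system T) {FFl : Filter Fl}
    (r : R) (J : V -> V -> R) (v_ : T -> V) (v : V) :
  uniformly_smooth V -> 1 < r -> (forall v, duality_mapping r v (J v)) ->
  v != 0 -> v_ @ Fl --> v -> dual_cvg Fl (fun a => J (v_ a)) (J v).
Proof.
move=> smV r1 JP v0 vv.
pose f (u : V) := fun h => (`|u| `^ (r - 1))^-1 * J u h.
have nv0 : 0 < `|v| by rewrite normr_gt0.
have fP u : u != 0 -> [/\ dual (f u), dual_norm (f u) <= 1 & f u (`|u|^-1 *: u) = 1].
  move=> u0; have [dJ nJ Ju] := JP u.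
  have nu0 : 0 < `|u| by rewrite normr_gt0.
  have pu0 : 0 < `|u| `^ (r - 1) by rewrite powR_gt0.
  have df : dual (f u).
    (* A multiple [c * J u] is written as [J u - (1 - c) * J u]. *)
    have := dual_comb (1 - (`|u| `^ (r - 1))^-1) dJ dJ; congr dual.
    by apply/funext => h; rewrite /f; ring.
  split=> //.
    apply: dual_norm_le => // h; rewrite /f normrM normfV (gtr0_norm pu0).
    by rewrite ler_pdivrMl// mul1r -nJ le_dual_norm.
  rewrite dualZ// /f Ju; have -> : `|u| `^ r = `|u| `^ (r - 1) * `|u|.
    by rewrite mulrC mulr_powRB1// (lt_trans _ r1).
  rewrite mulKf ?gt_eqF// mulVf// gt_eqF//.
have nvv : `|v_ a| @[a --> Fl] --> `|v| by exact: cvg_norm.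
have near0 : \forall a \near Fl, v_ a != 0.
  have /cvgrPdist_lt/(_ _ nv0) := vv; apply: filterS => a.
  by apply: contraTneq => ->; rewrite subr0 ltxx.
have [df nf fv] := fP _ v0.
have ff : dual_cvg Fl (fun a => f (v_ a)) (f v).
  move=> e e0; have [eta eta0 etaP] := uniformly_smooth_dual smV e0.
  have : `|v_ a|^-1 *: v_ a @[a --> Fl] --> `|v|^-1 *: v.
    by apply: cvgZ => //; apply: cvgV => //; rewrite gt_eqF.
  move/cvgrPdist_le/(_ _ eta0); move: near0; apply: filterS2 => a a0 av.
  have [dfa nfa fva] := fP _ a0.
  apply: (etaP (`|v_ a|^-1 *: v_ a) (`|v|^-1 *: v)) => //; last by rewrite distrC.
    by rewrite normrZ normfV normr_id mulVf// normr_eq0.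
  by rewrite normrZ normfV normr_id mulVf// normr_eq0.
have := dual_cvgZ df (cvg_powR (s := r - 1) nv0 nvv) ff.
move=> /(_ FFl FFl) H e e0; near=> a => h.
have a0 : v_ a != 0 by near: a.
have : `| `|v_ a| `^ (r - 1) * f (v_ a) h - `|v| `^ (r - 1) * f v h| <= e * `|h|.
  by move: h; near: a; exact: H.
by rewrite /f !mulrA !mulfV ?mul1r// gt_eqF// powR_gt0// normr_gt0.
Unshelve. all: by end_near.
Qed.

End UniformSmoothness.

(** * Uniformly convex functionals *)

Section PowerInequalities.
Context {R : realType}.
Implicit Types p s g k mu sigma : R.

Lemma ltr_powR_inv p s g : 0 < p -> 0 <= s -> 0 <= g -> s `^ p < g `^ p -> s < g.
Proof.
move=> p0 s0 g0; apply: contraTT; rewrite -!leNgt => gs.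
by apply: ge0_ler_powR => //; rewrite ?nnegrE// ltW.
Qed.

(* Young's inequality holds with [p * sigma] in place of [2 * sigma]; the weaker
   constant is the one in the definition of c0. *)
Lemma young_descent p sigma mu s g k : 2 <= p -> 0 < sigma -> 0 <= mu ->
  0 <= s -> 0 <= g -> 0 <= k -> g `^ p <= mu * k `^ (p - 1) ->
  g * s <= sigma * s `^ p + (p - 1) / p * (mu / (2 * sigma)) `^ (p - 1)^-1 * k.
Proof.
move=> p2 sg0 mu0 s0 g0 k0 gk.
have p0 : 0 < p by lra.
have p1 : 0 < p - 1 by lra.
have ps0 : 0 < p * sigma by rewrite mulr_gt0.
(* Young's inequality is applied to [(s * c) * (g / c)]; with [c ^ p = p * sigma] its first term is
   exactly [sigma * s ^ p]. *)
pose c := (p * sigma) `^ p^-1; have c0 : 0 < c by rewrite powR_gt0.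
have cp : c `^ p = p * sigma by rewrite -powRrM mulVf ?gt_eqF// powRr1// ltW.
pose q := p / (p - 1).
have q0 : 0 < q by rewrite divr_gt0.
have pq : p^-1 + q^-1 = 1 by rewrite /q; field; rewrite !gt_eqF.
have := conjugate_powR (mulr_ge0 s0 (ltW c0)) (divr_ge0 g0 (ltW c0)) p0 q0 pq.
have -> : s * c * (g / c) = g * s by field; rewrite gt_eqF.
move/le_trans; apply; apply: lerD.
  by rewrite (powRM _ s0 (ltW c0)) cp -mulrA [p * _ / p]mulrAC mulfV ?gt_eqF// mul1r mulrC.
rewrite ler_pdivrMr// [leRHS]mulrC mulrA.
have -> : q * ((p - 1) / p * (mu / (2 * sigma)) `^ (p - 1)^-1) =
   (mu / (2 * sigma)) `^ (p - 1)^-1 by rewrite /q; field; rewrite !gt_eqF.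
have -> : k = (k `^ (p - 1)) `^ (p - 1)^-1.
  by rewrite -powRrM mulfV ?gt_eqF// powRr1.
have sg2 : 0 <= 2 * sigma by lra.
rewrite /q powRrM -powRM ?powR_ge0 ?divr_ge0//.
apply: ge0_ler_powR; rewrite ?nnegrE ?invr_ge0 ?powR_ge0 ?(ltW p1)//.
  by rewrite mulr_ge0 ?divr_ge0 ?powR_ge0.
have cVp : c^-1 `^ p = (p * sigma)^-1.
  by rewrite -(powR_inv1 (ltW c0)) powRAC cp powR_inv1// ltW.
rewrite powRM ?invr_ge0 ?(ltW c0)// cVp.
rewrite ler_pdivrMr// (le_trans gk)// mulrAC ler_wpM2r ?powR_ge0//.
rewrite mulrAC ler_pdivlMr ?mulr_gt0// ler_wpM2l// ler_wpM2r// ltW//.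
Qed.

End PowerInequalities.

Lemma cvg_of_powR_cauchy {R : realType} (V : completeNormedModType R) (u : nat -> V)
    (a : nat -> R) (c p : R) : 0 < c -> 0 < p -> a @ \oo --> 0 ->
  (forall n m, c * `|u n - u m| `^ p <= a n + a m) -> cvg (u @ \oo).
Proof.
move=> c0 p0 a0 uP; apply/cauchy_cvgP/cauchyP => e /= e0.
have ce0 : 0 < c * e `^ p / 2 by rewrite divr_gt0 ?mulr_gt0 ?powR_gt0.
have /cvgrPdist_lt/(_ _ ce0)[M _ MP] := a0.
exists (u M); exists M => // n /= Mn; rewrite -ball_normE /ball_/=.
apply: (@ltr_powR_inv _ p) => //; first exact: ltW.
rewrite -(ltr_pM2l c0); apply: (le_lt_trans (uP _ _)).
have := MP _ Mn; have := MP _ (leqnn M); rewrite !sub0r !normrN.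
move=> /(le_lt_trans (ler_norm _)) + /(le_lt_trans (ler_norm _)); lra.
Qed.

Section ConvexAnalysis.
Context {R : realType} {X : normedModType R} (theta : X -> \bar R) (p sigma : R).
Hypothesis p_ge2 : 2 <= p.
Hypothesis theta_proper : proper_function theta.
Hypothesis sigma_gt0 : 0 < sigma.
Hypothesis bregman_ge : forall z x' zeta, dom_subdiff theta z -> subdiff theta z zeta ->
  ((sigma * `|x' - z| `^ p)%:E <= bregman theta zeta x' z)%E.

Let th z := fine (theta z).

Lemma eff_domE z : eff_dom theta z -> theta z = (th z)%:E.
Proof.
move=> /= zlt; have [ny _] := theta_proper.
by rewrite fineK// fin_real// zlt ltNye ny.
Qed.

Lemma eff_dom_fin z (a : R) : (theta z <= a%:E)%E -> eff_dom theta z.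
Proof. by move=> /= /le_lt_trans; apply; rewrite ltry. Qed.

(** Real-valued, so that linear arithmetic applies. Since [fine] sends infinities to 0, it is
    meaningful only when both points are in the effective domain. *)
Definition bregman_real (zeta : X -> R) (x' x : X) : R :=
  fine (theta x') - fine (theta x) - zeta (x' - x).

Lemma bregmanE zeta x' x : eff_dom theta x' -> eff_dom theta x ->
  bregman theta zeta x' x = (bregman_real zeta x' x)%:E.
Proof. by move=> ex' ex; rewrite /bregman (eff_domE ex) (eff_domE ex'). Qed.

Definition subgradient z zeta := eff_dom theta z /\ subdiff theta z zeta.

Lemma bregman_real_ge z x' zeta : subgradient z zeta -> eff_dom theta x' ->
  sigma * `|x' - z| `^ p <= bregman_real zeta x' z.
Proof.
move=> [ez sz] ex'; rewrite -lee_fin -bregmanE//; apply: bregman_ge => //.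
by split=> //; exists zeta.
Qed.

Lemma bregman_real_ge0 z x' zeta : subgradient z zeta -> eff_dom theta x' ->
  0 <= bregman_real zeta x' z.
Proof.
move=> sz ex'; apply: le_trans (bregman_real_ge sz ex').
by rewrite mulr_ge0 ?powR_ge0// ltW.
Qed.

Lemma argmin_subgradient zeta z : dual zeta ->
  is_argmin (fun u => theta u - (zeta u)%:E)%E z -> subgradient z zeta.
Proof.
move=> dz am; have [ny [w ew]] := theta_proper.
have ez : eff_dom theta z.
  move: (am w); rewrite (eff_domE ew) /eff_dom/= -EFinB.
  by case: (theta z) => [a| |] //= *; rewrite ?ltry.
split=> //; split=> // u; move: (am u); rewrite (eff_domE ez).
case: (theta u) (ny u) => [b| |] //= _; last by move=> _; rewrite leey.
by rewrite -EFinB -EFinD !lee_fin dualB//; lra.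
Qed.

(** Adding the two Bregman inequalities between [z] and [z'] cancels the values of theta. *)
Lemma subgradient_monotone z z' zeta zeta' : subgradient z zeta ->
  subgradient z' zeta' -> 2 * sigma * `|z - z'| `^ p <= zeta (z - z') - zeta' (z - z').
Proof.
move=> sz sz'; have := bregman_real_ge sz sz'.1; have := bregman_real_ge sz' sz.1.
have [_ [dz _]] := sz; have [_ [dz' _]] := sz'.
rewrite /bregman_real -[z' - z]opprB normrN (dualN _ dz); lra.
Qed.

(** It makes the argmin of the method unique, so any two iterates with the same dual variable
    coincide. *)
Lemma subgradient_unique z z' zeta : subgradient z zeta -> subgradient z' zeta -> z = z'.
Proof.
move=> sz sz'; have := subgradient_monotone sz sz'; rewrite subrr.
rewrite pmulr_rle0 ?mulr_gt0// => H.
have : `|z - z'| `^ p == 0 by rewrite eq_le H powR_ge0.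
by rewrite powR_eq0 => /andP[+ _]; rewrite normr_eq0 subr_eq0 => /eqP.
Qed.

(** Strong monotonicity divided by [|z - z'|]: the gradient of the conjugate of theta is Hölder
    continuous with exponent 1 / (p - 1). *)
Lemma subgradient_lipschitz z z' zeta zeta' e : 0 <= e ->
  subgradient z zeta -> subgradient z' zeta' ->
  (forall h, `|zeta h - zeta' h| <= e * `|h|) -> 2 * sigma * `|z - z'| `^ (p - 1) <= e.
Proof.
move=> e0 sz sz' zz'.
have p1 : 0 < p - 1 by rewrite subr_gt0 (lt_le_trans _ p_ge2)// ltr1n.
have [->|zz'0] := eqVneq z z'.
  by rewrite subrr normr0 powR0 ?mulr0// gt_eqF.
have n0 : 0 < `|z - z'| by rewrite normr_gt0 subr_eq0.
rewrite -(ler_pM2r n0) (le_trans _ (zz' _))//.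
apply: le_trans (ler_norm _); apply: le_trans (subgradient_monotone sz sz').
rewrite -(mulr_powRB1 (p := p) (ltW n0)); last by rewrite (lt_le_trans _ p_ge2).
by rewrite [X in _ <= _ * X]mulrC mulrA.
Qed.

Lemma lsc_le (u : nat -> X) (l : X) (b : nat -> R) (c : R) :
  lower_semicontinuous theta -> u @ \oo --> l -> b @ \oo --> c ->
  (\forall n \near \oo, (theta (u n) <= (b n)%:E)%E) -> (theta l <= c%:E)%E.
Proof.
move=> lsc ul bc ub; rewrite leNgt; apply/negP => cl.
(* A level strictly between [c] and [theta l]: near [l], theta stays above it, while [b n]
   eventually falls below it. *)
have [a [ca al]] : exists a : R, c < a /\ (a%:E < theta l)%E.
  have [ny _] := theta_proper.
  case: (theta l) (ny l) cl => [t| |] //= _ ct.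
    exists ((c + t) / 2); move: ct; rewrite !lte_fin => ct; split; lra.
  by exists (c + 1); rewrite ltry; split=> //; lra.
have [V Vl VP] := lsc _ _ al.
have : \forall n \near \oo, False; last by move=> /filter_ex[].
near=> n.
have /VP : V (u n) by near: n; exact: ul.
apply/negP; rewrite -leNgt.
have /le_trans : (theta (u n) <= (b n)%:E)%E by near: n.
apply; rewrite lee_fin ltW//; near: n.
exact: (cvgr_lt c bc).
Unshelve. all: by end_near.
Qed.

End ConvexAnalysis.

(* Minimizing sequences are Cauchy by p-convexity, so completeness of X suffices. *)
Lemma argmin_exists {R : realType} {X : completeNormedModType R} (theta : X -> \bar R)
    (p sigma : R) (x0 : X) (xi0 zeta : X -> R) : 2 <= p -> 0 < sigma ->
  proper_function theta -> lower_semicontinuous theta -> p_convex p theta ->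
  (forall z x' zeta, dom_subdiff theta z -> subdiff theta z zeta ->
     ((sigma * `|x' - z| `^ p)%:E <= bregman theta zeta x' z)%E) ->
  subgradient theta x0 xi0 -> dual zeta ->
  exists z, is_argmin (fun u => theta u - (zeta u)%:E)%E z.
Proof.
move=> p2 sg0 pr lsc [s s0 cvx] bg sx0 dz.
have p0 : 0 < p by lra.
have [_ [dxi0 _]] := sx0.
have ex0 := sx0.1.
pose th z := fine (theta z).
pose f z := th z - zeta z.
pose E := [set f z | z in eff_dom theta].
pose K := dual_norm (fun h => zeta h - xi0 h).
have dzx := dual_sub dz dxi0.
have K0 : 0 <= K by exact: dual_norm_ge0.
(* Up to a Bregman distance of at least [sigma * |z - x0| ^ p], the function [f] changes from [x0]
   to [z] by at most [K * |z - x0|]; Young's inequality with [mu = K ^ p] and [k = 1] bounds the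
   loss by this [c]. *)
pose c := (p - 1) / p * (K `^ p / (2 * sigma)) `^ (p - 1)^-1.
have fge z : eff_dom theta z -> f x0 - c <= f z.
  move=> ez; have := bregman_real_ge pr bg sx0 ez.
  have := @young_descent _ p sigma (K `^ p) `|z - x0| K 1 p2 sg0 (powR_ge0 _ _)
    (normr_ge0 _) K0 ler01.
  rewrite powR1 !mulr1 -/c => /(_ (lexx _)).
  have := le_trans (ler_norm _) (le_dual_norm (z - x0) dzx); rewrite -/K.
  rewrite /f /bregman_real -/(th _) -/(th _) (dualB _ _ dz) => *; lra.
have hE : has_inf E.
  split; first by exists (f x0), x0.
  by exists (f x0 - c) => _ [z ez <-]; exact: fge.
pose m := inf E.
have mle z : eff_dom theta z -> m <= f z.
  by move=> ez; apply: ge_inf; [exact: hE.2|exists z].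
have [z zP] : {z : nat -> X & forall n, eff_dom theta (z n) /\ f (z n) < m + n.+1%:R^-1}.
  apply: (@choice _ _ (fun n z => eff_dom theta z /\ f z < m + n.+1%:R^-1)) => n.
  have n0 : 0 < n.+1%:R^-1 :> R by rewrite invr_gt0.
  by have [_ [z ez <-] fz] := inf_adherent n0 hE; exists z.
have cz : cvg (z @ \oo).
  (* At the midpoint, p-convexity gains [s / 4 * |z n - z k| ^ p], while the mean of the two values
     exceeds the infimum by at most half of [n.+1^-1 + k.+1^-1]; doubling gives [s / 2]. *)
  apply: (@cvg_of_powR_cauchy _ _ z (fun n => n.+1%:R^-1) (s / 2) p) => //.
    by rewrite divr_gt0.
    exact: cvg_harmonic.
  move=> n k; have [en fn] := zP n; have [ek fk] := zP k.
  have half : 0 <= (2^-1 : R) <= 1 by rewrite invr_ge0 ler0n invf_le1// ler1n.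
  have := cvx (z n) (z k) _ half.
  rewrite (eff_domE pr en) (eff_domE pr ek) -!EFinM -EFinD.
  set w := (_ *: _ + _)%R => H.
  have ew : eff_dom theta w.
    have [ny _] := pr.
    move: H; rewrite /eff_dom/=; case: (theta w) (ny w) => [a| |] //= _.
      by rewrite ltry.
  move: H (mle _ ew); rewrite (eff_domE pr ew) -EFinD lee_fin /f.
  have -> : zeta w = 2^-1 * zeta (z n) + 2^-1 * zeta (z k).
    rewrite /w (dualD _ _ dz) !(dualZ _ _ dz); by field.
  move: fn fk; rewrite /f /th; set A := (`|z n - z k| `^ p).
  set B := n.+1%:R^-1; set C := k.+1%:R^-1; lra.
pose l := lim (z @ \oo); exists l.
have zl : z @ \oo --> l by [].
have cl : (theta l <= (m + zeta l)%:E)%E.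
  apply: (lsc_le pr lsc zl (b := fun n => m + n.+1%:R^-1 + zeta (z n))).
    rewrite -[m in X in _ --> X]addr0; apply: cvgD; first apply: cvgD.
    - exact: cvg_cst.
    - exact: cvg_harmonic.
    - by have [_ cz'] := dz; apply: continuous_cvg => //; exact: cz'.
  apply: nearW => n; have [en] := zP n.
  rewrite (eff_domE pr en) lee_fin /f /th/= => fn; set B := n.+1%:R^-1 in fn *; lra.
have el := eff_dom_fin cl.
move=> u; move: cl; rewrite (eff_domE pr el) lee_fin => cl.
have [ny _] := pr.
have [eu|] := boolP (theta u < +oo)%E; last first.
  by rewrite -leNgt leye_eq => /eqP ->; rewrite addye// leey.
rewrite (eff_domE pr eu) -!EFinB lee_fin; have := mle _ eu; rewrite /f /th; lra.
Qed.

(** * Convergence and measurability lemmas *)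

(** Both factors are replaced by the larger of [a] and [b]. In the Cauchy estimate this turns
    products of residuals at two different iterates into a total residual. *)
Lemma powR_mul_le {R : realType} (p a b c : R) : 1 <= p -> 0 <= a -> 0 <= b ->
  a `^ p <= c -> b `^ p <= c -> a `^ (p - 1) * b <= c.
Proof.
move=> p1 a0 b0 ac bc; have p0 : 0 < p by lra.
have [ab|/ltW ba] := leP a b.
  apply: le_trans bc; rewrite -[leRHS](mulr_powRB1 b0 p0) mulrC ler_wpM2l//.
  by apply: ge0_ler_powR; rewrite ?nnegrE// subr_ge0.
apply: le_trans ac; rewrite -[leRHS](mulr_powRB1 a0 p0) mulrC.
by rewrite ler_wpM2r ?powR_ge0.
Qed.

Lemma cvg_of_powR_le {R : realType} (V : normedModType R) (u : nat -> V) (l : V)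
    (a : nat -> R) (c p : R) : 0 < c -> 0 < p -> a @ \oo --> 0 ->
  (forall n, c * `|l - u n| `^ p <= a n) -> u @ \oo --> l.
Proof.
move=> c0 p0 a0 uP; apply/cvgrPdist_lt => e e0.
have ce0 : 0 < c * e `^ p by rewrite mulr_gt0 ?powR_gt0.
move/cvgrPdist_lt/(_ _ ce0): a0; apply: filterS => n.
rewrite sub0r normrN => /(le_lt_trans (ler_norm _))/(le_lt_trans (uP n)).
by rewrite ltr_pM2l// => /(ltr_powR_inv p0); apply; rewrite // ltW.
Qed.

(** If [u] has vanished by time [n], it stays 0 and [n] itself is a record. Otherwise the minimum up
    to [n] is positive, and the first later value below it is a record. *)
Lemma record_low {R : realType} (u : nat -> R) : (forall n, 0 <= u n) ->
  u @ \oo --> 0 -> (forall n, u n = 0 -> u n.+1 = 0) ->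
  forall n, exists2 k, (n <= k)%N & forall m, (m < k)%N -> u k <= u m.
Proof.
move=> u_ge0 u0 u_stay n.
have [/existsP[m /eqP um]|/existsPn nz] := boolP [exists m : 'I_n.+1, u m == 0].
  exists n => // k kn; have um0 j : (m <= j)%N -> u j = 0.
    by move/subnK <-; elim: (j - m)%N => //= i; exact: u_stay.
  by rewrite um0 // -ltnS.
pose c := \big[Num.min/u 0]_(m < n.+1) u m.
have cpos : 0 < c.
  rewrite /c; elim/big_ind: _ => [|a b a0 b0|i _]; last by rewrite lt_neqAle eq_sym nz /=.
    by rewrite lt_neqAle eq_sym (nz ord0)/=.
  by rewrite lt_min a0.
have cle m : (m <= n)%N -> c <= u m.
  move=> mn; rewrite /c (bigD1 (Ordinal (mn : m < n.+1)%N)) //=.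
  by rewrite ge_min lexx.
have exk : exists k, u k < c.
  have /cvgrPdist_lt/(_ _ cpos)[M _ MP] := u0; exists M.
  by have := MP M (leqnn _); rewrite /= sub0r normrN ger0_norm.
case: (ex_minnP exk) => k uk kmin; exists k => [|m mk].
  by rewrite leqNgt; apply/negP => /ltnW/cle; rewrite leNgt uk.
rewrite (le_trans (ltW uk))// leNgt; apply/negP => /kmin.
by rewrite leqNgt mk.
Qed.

Lemma cvg_minr {R : realType} {T : Type} (Fl : set_system T) {FFl : Filter Fl}
    (u v : T -> R) (a b : R) : u @ Fl --> a -> v @ Fl --> b ->
  Num.min (u x) (v x) @[x --> Fl] --> Num.min a b.
Proof.
move=> ua vb; rewrite minr_absE.
under eq_fun do rewrite minr_absE.
apply: cvgM; last exact: cvg_cst.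
by apply: cvgB; [exact: cvgD|apply: cvg_norm; exact: cvgB].
Qed.

Section NoiseFilter.
Context {R : realType} {N : nat}.
Implicit Types delta : 'I_N -> R.

Lemma noise_to0_filter (r : R) : Filter (@noise_to0 R N r).
Proof.
apply: filter_from_filter; first by exists 1 => /=.
move=> e1 e2 /= e10 e20; exists (Num.min e1 e2); first by rewrite /= lt_min e10.
by move=> delta /= [dp]; rewrite lt_min => /andP[de1 de2].
Qed.

Lemma noise_to0_gt0 (r : R) :
  \forall delta \near @noise_to0 R N r, forall i, 0 < delta i.
Proof. by exists 1 => //= delta []. Qed.

Lemma le_noise_level (r : R) delta i : 0 < r -> (forall j, 0 < delta j) ->
  delta i <= noise_level r delta.
Proof.
move=> r0 dp; rewrite /noise_level.
have -> : delta i = (delta i `^ r) `^ r^-1.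
  by rewrite -powRrM mulfV ?gt_eqF// powRr1// ltW.
apply: ge0_ler_powR; rewrite ?invr_ge0 ?(ltW r0) ?nnegrE ?powR_ge0//.
  by apply: sumr_ge0 => j _; exact: powR_ge0.
by rewrite (bigD1 i)//= lerDl; apply: sumr_ge0 => j _; exact: powR_ge0.
Qed.

Lemma noise_to0_cvg (r : R) i : 0 < r -> delta i @[delta --> @noise_to0 R N r] --> 0.
Proof.
move=> r0; have FF := noise_to0_filter r; apply/cvgrPdist_lt => e e0.
exists e => // delta [dp de]; rewrite sub0r normrN gtr0_norm//.
exact: le_lt_trans (le_noise_level i r0 dp) de.
Qed.

End NoiseFilter.

Lemma cvge0_squeeze {R : realType} {T : Type} (Fl : set_system T) {FFl : Filter Fl}
    (f : T -> \bar R) : (forall e : R, 0 < e -> \forall a \near Fl, (0 <= f a <= e%:E)%E) ->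
  f @ Fl --> 0%E.
Proof.
move=> fe; apply/fine_cvgP; split.
  apply: filterS (fe 1 ltr01) => a /andP[f0 f1].
  by rewrite ge0_fin_numE// (le_lt_trans f1)// ltry.
apply/cvgrPdist_le => e e0; apply: filterS (fe e e0) => a /andP[f0 f1] /=.
rewrite sub0r normrN ger0_norm ?fine_ge0// -lee_fin fineK//.
by rewrite ge0_fin_numE// (le_lt_trans f1)// ltry.
Qed.

(** The limit lies in [U] exactly when, for some [m], almost all terms lie in [V m], the points of
    [U] at depth [1 / (m + 1)]. Measurability of the preimages of all sets is available because each
    iterate is a function of a finite word. *)
Lemma borel_measurable_cvg {R : realType} {d} {T : measurableType d} {X : normedModType R}
    (G : set T) (f_ : nat -> T -> X) (f : T -> X) (b : X) : measurable G ->
  (forall n A, measurable (f_ n @^-1` A)) ->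
  (forall w, G w -> f_ n w @[n --> \oo] --> f w) -> (forall w, ~ G w -> f w = b) ->
  borel_measurable f.
Proof.
move=> mG mf fG fb U openU.
pose V m := [set z : X | ball z m.+1%:R^-1 `<=` U].
have -> : f @^-1` U = (G `&` \bigcup_m \bigcup_M \bigcap_k (f_ (M + k)%N @^-1` V m))
    `|` (~` G `&` [set _ | U b]).
  apply/seteqP; split=> w /=.
    have [Gw Uw|Gw] := pselect (G w); last by rewrite (fb _ Gw) => Ub; right.
    left; split=> //.
    have /nbhs_ballP[e /= e0 eU] := open_nbhs_nbhs (conj openU Uw).
    have [m me] : exists m : nat, m.+1%:R^-1 < e / 2.
      have e20 : 0 < e / 2 by rewrite divr_gt0.
      have /cvgrPdist_lt/(_ _ e20)[M _ MP] := @cvg_harmonic R; exists M.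
      by have := MP _ (leqnn M); rewrite /= sub0r normrN ger0_norm.
    have /cvgrPdist_lt/(_ (m.+1%:R^-1))[|M _ MP] := fG _ Gw; first by rewrite invr_gt0.
    exists m => //; exists M => // k _ z; rewrite -ball_normE /ball_/= => fz.
    apply: eU; rewrite -ball_normE /ball_/= [e]splitr.
    rewrite -(subrKA (f_ (M + k)%N w)) (le_lt_trans (ler_normD _ _))// ltrD//.
      by apply: lt_trans me; apply: MP; rewrite /= leq_addr.
    exact: lt_trans fz me.
  move=> [[Gw [m _ [M _ H]]]|[Gw Ub]]; last by rewrite /= fb.
  have /cvgrPdist_lt/(_ (m.+1%:R^-1))[|M' _ MP] := fG _ Gw; first by rewrite invr_gt0.
  have /(_ (f w)) := H M' I; apply; rewrite -ball_normE /ball_/= distrC.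
  by apply: MP; rewrite /= leq_addl.
apply: measurableU.
  apply: measurableI => //; apply: bigcupT_measurable => m.
  by apply: bigcupT_measurable => M; apply: bigcapT_measurable => k; exact: mf.
apply: measurableI; first exact: measurableC.
have [Ub|nUb] := pselect (U b).
  by rewrite (_ : [set _ | _] = setT) //; apply/seteqP; split.
by rewrite (_ : [set _ | _] = set0) //; apply/seteqP; split.
Qed.

(** * The iteration *)

Record sgd_setting {R : realType} {N : nat} {X : completeNormedModType R}
  {Y : 'I_N -> completeNormedModType R}
  (domF : 'I_N -> set X) (F : forall i, X -> Y i) (dF : forall i, X -> X -> Y i)
  (y : forall i, Y i) (theta : X -> \bar R)
  (p r sigma rho eta B0 mu0 mu1 tau : R) (x0 : X) (xi0 : X -> R)
  (J : forall i, Y i -> Y i -> R) : Prop := SgdSetting {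
  p_ge2 : 2 <= p;
  theta_proper : proper_function theta;
  theta_lsc : lower_semicontinuous theta;
  theta_p_convex : p_convex p theta;
  sigma_gt0 : 0 < sigma;
  theta_bregman : forall z x' zeta, dom_subdiff theta z -> subdiff theta z zeta ->
     ((sigma * `|x' - z| `^ p)%:E <= bregman theta zeta x' z)%E;
  start_subgradient : subgradient theta x0 xi0;
  Y_smooth : forall i, uniformly_smooth (Y i);
  rho_gt0 : 0 < rho;
  ball_dom : closed_ball_ Num.norm x0 (2 * rho) `<=` common_dom domF;
  near_solution : exists xs, [/\ solution domF F y xs, eff_dom theta xs &
     (bregman theta xi0 xs x0 <= (sigma * rho `^ p)%:E)%E];
  F_frechet : forall i z, common_dom domF z ->
     frechet_within (common_dom domF) (F i) z (dF i z);
  dF_continuous : forall i z, closed_ball_ Num.norm x0 (2 * rho) z ->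
     opnorm (fun h => dF i z' h - dF i z h)
       @[z' --> within (closed_ball_ Num.norm x0 (2 * rho)) (nbhs z)]
       --> (0 : R);
  B0_gt0 : 0 < B0;
  dF_bound : forall i z, closed_ball_ Num.norm x0 (2 * rho) z -> opnorm (dF i z) <= B0;
  eta_range : 0 <= eta < 1;
  tangential_cone : forall i z z', closed_ball_ Num.norm x0 (2 * rho) z ->
     closed_ball_ Num.norm x0 (2 * rho) z' ->
     `|F i z - F i z' - dF i z' (z - z')| <= eta * `|F i z - F i z'|;
  r_gt1 : 1 < r;
  J_duality : forall i v, duality_mapping r v (J i v);
  mu0_gt0 : 0 < mu0;
  mu1_gt0 : 0 < mu1;
  tau_gt1 : 1 < tau;
  c0_gt0 : 0 < 1 - eta - (1 + eta) / tau
      - (p - 1) / p * (mu0 / (2 * sigma)) `^ (p - 1)^-1 }.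

Section States.
Context {R : realType} {N : nat} {X : completeNormedModType R}
  {Y : 'I_N -> completeNormedModType R}.
Variables (F : forall i, X -> Y i) (dF : forall i, X -> X -> Y i)
  (J : forall i, Y i -> Y i -> R) (theta : X -> \bar R) (p r mu0 mu1 tau : R)
  (x0 : X) (xi0 : X -> R).

(** One step as a function of the pair of dual and primal iterate. The point [x0] is only the
    default of [xget]: [argmin_exists] provides a minimizer. *)
Definition sgd_next (dl : 'I_N -> R) (yn : forall i, Y i) (i : 'I_N)
    (s : (X -> R) * X) : (X -> R) * X :=
  let res := F i s.2 - yn i in
  let zeta := fun h => s.1 h - sgd_step dF J p r mu0 mu1 tau (dl i) s.2 res *
                               sgd_direction dF J s.2 res h in
  (zeta, xget x0 [set z | is_argmin (fun u => theta u - (zeta u)%:E)%E z]).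

(* The drawn indices are listed from the latest to the earliest. *)
Definition sgd_state dl yn (l : seq 'I_N) := foldr (sgd_next dl yn) (xi0, x0) l.

Fixpoint past (ind : nat -> 'I_N) (n : nat) : seq 'I_N :=
  if n is m.+1 then ind m :: past ind m else [::].

Lemma size_past ind n : size (past ind n) = n.
Proof. by elim: n => //= n ->. Qed.

End States.

(** * Independent uniform indices *)

Lemma past_congr N (s s' : nat -> 'I_N) n :
  past s n = past s' n <-> forall k, (k < n)%N -> s k = s' k.
Proof.
elim: n => [//|n IH]; split=> [[sn /IH H] k|H] /=.
  by rewrite ltnS leq_eqVlt => /orP[/eqP ->//|]; exact: H.
by rewrite H//; congr cons; apply/IH => k kn; apply: H; exact: ltnW.
Qed.

(** Every word is the past of some sequence. Time is reversed because the head of a word is the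
    latest index. *)
Lemma past_nth N (j0 : 'I_N) l :
  past (fun k => nth j0 l (size l - k.+1)) (size l) = l.
Proof.
elim: l => [//|i l IH] /=; rewrite subnn/=; congr cons; rewrite -[RHS]IH.
by apply/past_congr => k kl; rewrite subSn.
Qed.

(** The inner sum runs over the index drawn last, so it plays the role of the conditional
    expectation given the earlier ones. *)
Lemma big_tuple_cons {R : nmodType} (I : finType) n (f : seq I -> R) :
  \sum_(t : n.+1.-tuple I) f t = \sum_(t : n.-tuple I) \sum_(i : I) f (i :: t).
Proof.
rewrite pair_big/=.
rewrite (reindex (fun q : n.-tuple I * I => [tuple of q.2 :: q.1])) //=.
exists (fun t : n.+1.-tuple I => ([tuple of behead t], thead t)).
  by move=> [t i] _ /=; congr pair; exact: val_inj.
by move=> t _ /=; rewrite [RHS]tuple_eta; apply/val_inj.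
Qed.

Section Past.
Context {d : measure_display} {T : measurableType d} {R : realType}
  (P : probability T R) {N : nat} (ind : nat -> T -> 'I_N).
Hypothesis iid : iid_uniform P ind.
Hypothesis N_gt0 : (0 < N)%N.

Lemma measurable_past_eq n l : measurable [set w | past (ind^~ w) n = l].
Proof.
have [mind _ _] := iid.
elim: n l => [|n IH] [|i l] /=.
- by rewrite (_ : [set _ | _] = setT) //; apply/seteqP; split.
- by rewrite (_ : [set _ | _] = set0) //; apply/seteqP; split.
- by rewrite (_ : [set _ | _] = set0) //; apply/seteqP; split.
rewrite (_ : [set _ | _] = ind n @^-1` [set i] `&` [set w | past (ind^~ w) n = l]).
  exact: measurableI.
by apply/seteqP; split=> w /= [-> ->].
Qed.

Lemma measurable_past n (A : set (seq 'I_N)) :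
  measurable [set w | A (past (ind^~ w) n)].
Proof.
rewrite (_ : [set _ | _] = \bigcup_l ([set w | past (ind^~ w) n = l] `&` [set _ | A l])).
  apply: countable_bigcupT_measurable => [|l]; first exact: countableP.
  apply: measurableI; first exact: measurable_past_eq.
  have [Al|nAl] := pselect (A l).
    by rewrite (_ : [set _ | _] = setT) //; apply/seteqP; split.
  by rewrite (_ : [set _ | _] = set0) //; apply/seteqP; split.
apply/seteqP; split=> [w /= Aw|w [l _ [/= <-]]//].
by exists (past (ind^~ w) n).
Qed.

Lemma measurable_fun_past n (d' : measure_display) (U : measurableType d') (g : seq 'I_N -> U) :
  measurable_fun setT (fun w => g (past (ind^~ w) n)).
Proof.
move=> _ B mB; rewrite setTI.
exact: (measurable_past n (g @^-1` B)).
Qed.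

Lemma prob_past n (l : n.-tuple 'I_N) :
  P [set w | past (ind^~ w) n = l] = ((N%:R^-1) ^+ n)%:E.
Proof.
have [mind unif indep] := iid; pose j0 : 'I_N := Ordinal N_gt0.
pose s k := nth j0 l (n - k.+1).
have ls : tval l = past s n by rewrite -[LHS](past_nth j0) size_tuple.
rewrite (_ : [set _ | _] = \bigcap_(k in [set` iota 0 n]) (ind k @^-1` [set s k])).
  rewrite indep ?iota_uniq//.
  under eq_bigr do rewrite unif.
  rewrite -[in RHS](size_iota 0 n); elim: (iota 0 n) => [|k ks IH].
    by rewrite big_nil.
  by rewrite big_cons IH -EFinM -exprS.
apply/seteqP; split=> w /=; rewrite ls.
  by move=> /past_congr H k /=; rewrite mem_iota add0n => /andP[_]; exact: H.
by move=> H; apply/past_congr => k kn; apply: H; rewrite /= mem_iota.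
Qed.

(** Reduces expectations to finite averages over equally likely words, so that conditioning becomes
    a rearrangement of sums. *)
Lemma integral_past n (g : seq 'I_N -> R) : (forall l, 0 <= g l) ->
  (\int[P]_w (g (past (ind^~ w) n))%:E =
   ((N%:R^-1) ^+ n * \sum_(t : n.-tuple 'I_N) g t)%:E)%E.
Proof.
move=> g0; pose A (t : n.-tuple 'I_N) := [set w | past (ind^~ w) n = t].
have gE w : (g (past (ind^~ w) n))%:E =
    (\sum_(t : n.-tuple 'I_N) (g t)%:E * (\1_(A t) w)%:E)%E.
  have sz : size (past (ind^~ w) n) == n by rewrite size_past.
  rewrite (bigD1 (Tuple sz))//= indicE mem_set// mule1 big1 ?adde0// => t tn.
  rewrite indicE memNset ?mule0// => /= wt; move/eqP: tn; apply.
  by apply/val_inj; rewrite /= wt.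
under eq_integral do rewrite gE.
rewrite ge0_integral_sum//.
- rewrite mulr_sumr -sumEFin; apply: eq_bigr => t _.
  rewrite ge0_integralZl_EFin//.
  + rewrite integral_indic ?setIT//; last exact: measurable_past_eq.
    by rewrite [X in (_ * X)%E](prob_past t) -EFinM mulrC.
  + apply/measurable_EFinP/measurable_indic; exact: measurable_past_eq.
- move=> t; apply: emeasurable_funM; first exact: measurable_cst.
  apply/measurable_EFinP/measurable_indic; exact: measurable_past_eq.
- by move=> t w _; rewrite mule_ge0 ?lee_fin.
Qed.

End Past.

(* Spares the measurability of Bregman distances to the random limit. *)
Lemma ge0_le_integral_nonmeasurable d (T : measurableType d) (R : realType)
    (mu : {measure set T -> \bar R}) (f g : T -> \bar R) :
  (forall w, 0 <= f w)%E -> (forall w, f w <= g w)%E ->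
  (\int[mu]_w f w <= \int[mu]_w g w)%E.
Proof.
move=> f0 fg.
have g0 w : (0 <= g w)%E by exact: le_trans (f0 w) (fg w).
rewrite !ge0_integralTE//; apply: le_ereal_sup => _ [h /= hf <-].
by exists h => //= w; exact: le_trans (hf w) (fg w).
Qed.

(** * Convergence of the method *)

Section StochasticGradientDescent.
Context {R : realType} {N : nat} {X : completeNormedModType R}
  {Y : 'I_N -> completeNormedModType R}
  {domF : 'I_N -> set X} {F : forall i, X -> Y i} {dF : forall i, X -> X -> Y i}
  {y : forall i, Y i} {theta : X -> \bar R}
  {p r sigma rho eta B0 mu0 mu1 tau : R} {x0 : X} {xi0 : X -> R}
  {J : forall i, Y i -> Y i -> R}.
Context (S : sgd_setting domF F dF y theta p r sigma rho eta B0 mu0 mu1 tau x0 xi0 J).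

Local Notation B := (closed_ball_ Num.norm x0 (2 * rho)).
Local Notation direction := (sgd_direction dF J).
Local Notation step := (sgd_step dF J p r mu0 mu1 tau).
Local Notation D := (bregman_real theta).
Local Notation state := (sgd_state F dF J theta p r mu0 mu1 tau x0 xi0).
Local Notation next := (sgd_next F dF J theta p r mu0 mu1 tau x0).
Local Notation c0 := (1 - eta - (1 + eta) / tau
  - (p - 1) / p * (mu0 / (2 * sigma)) `^ (p - 1)^-1).
(** Exact data are treated as noise of level 0: the switch then reads [0 < |res|]. *)
Local Notation exact := (state (fun=> 0) y).
Implicit Types (dl : 'I_N -> R) (yn : forall i, Y i) (l : seq 'I_N).

Let p_gt0 : 0 < p. Proof. by have := p_ge2 S; lra. Qed.
Let p1_gt0 : 0 < p - 1. Proof. by have := p_ge2 S; lra. Qed.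
Let r_gt0 : 0 < r. Proof. by have := r_gt1 S; lra. Qed.
Let eta_ge0 : 0 <= eta. Proof. by have /andP[] := eta_range S. Qed.
Let tau_gt0 : 0 < tau. Proof. by have := tau_gt1 S; lra. Qed.

(** * Estimates for a single step *)

Lemma dF_bounded i z : B z -> bounded_operator (dF i z).
Proof. by move=> Bz; have [] := F_frechet S i (ball_dom S Bz). Qed.

Lemma dF_le i z h : B z -> `|dF i z h| <= B0 * `|h|.
Proof.
move=> Bz; apply: le_trans (le_opnorm h (dF_bounded i Bz)) _.
by rewrite ler_wpM2r//; exact: (dF_bound S).
Qed.

Lemma dF_le_residual i z z' : B z -> B z' ->
  `|dF i z' (z - z')| <= (1 + eta) * `|F i z - F i z'|.
Proof.
move=> Bz Bz'; have H := tangential_cone S i Bz Bz'.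
rewrite -[dF i z' _](subKr (F i z - F i z')) mulrDl mul1r.
by rewrite (le_trans (ler_normB _ _))// lerD2l.
Qed.

(** By the cone condition the increment of [F i] differs from its linearization by at most [eta]
    times itself, so a bound on the derivative suffices. *)
Lemma F_lipschitz i z z' : B z -> B z' ->
  (1 - eta) * `|F i z - F i z'| <= B0 * `|z - z'|.
Proof.
move=> Bz Bz'; have H := tangential_cone S i Bz Bz'.
rewrite (le_trans _ (dF_le i (z - z') Bz'))// mulrBl mul1r lerBlDr.
rewrite -[X in `|X| <= _](subrK (dF i z' (z - z'))) addrC.
by rewrite (le_trans (ler_normD _ _))// lerD2l.
Qed.

Lemma direction_dual i z (v : Y i) : B z -> dual (direction z v).
Proof.
move=> Bz; apply: dual_adjoint; first exact: dF_bounded.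
by have [] := J_duality S v.
Qed.

Lemma direction_norm_le i z (v : Y i) : B z ->
  dual_norm (direction z v) <= B0 * `|v| `^ (r - 1).
Proof.
move=> Bz; have [dJ nJ _] := J_duality S v.
apply: dual_norm_le; first by rewrite mulr_ge0 ?powR_ge0// ltW// (B0_gt0 S).
move=> h; apply: le_trans (le_dual_norm _ dJ) _.
by rewrite nJ mulrC mulrAC ler_wpM2r ?powR_ge0// dF_le.
Qed.

Lemma scaling_range i z (v : Y i) :
  0 <= sgd_scaling dF J p r mu0 mu1 z v <= mu1.
Proof.
rewrite /sgd_scaling; case: ifPn => _; first by rewrite ltW ?lexx// (mu1_gt0 S).
rewrite ge_min lexx orbT le_min (ltW (mu1_gt0 S)) !andbT.
by rewrite divr_ge0 ?mulr_ge0 ?powR_ge0// ltW// (mu0_gt0 S).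
Qed.

Lemma step_ge0 di i z (v : Y i) : 0 <= step di z v.
Proof.
rewrite /sgd_step; case: ifPn => // _.
by have /andP[? _] := scaling_range z v; rewrite mulr_ge0 ?powR_ge0.
Qed.

Lemma step_cases di i z (v : Y i) : 0 <= di ->
  step di z v = 0 \/ [/\ 0 < `|v|, tau * di < `|v| &
    step di z v = sgd_scaling dF J p r mu0 mu1 z v * `|v| `^ (p - r)].
Proof.
move=> di0; rewrite /sgd_step; case: ifPn => [H|_]; [right|by left].
by split=> //; apply: le_lt_trans H; rewrite mulr_ge0// ltW.
Qed.

Lemma step_le di i z (v : Y i) : 0 <= di ->
  step di z v * `|v| `^ (r - 1) <= mu1 * `|v| `^ (p - 1).
Proof.
move=> di0; case: (step_cases z v di0) => [->|[v0 _ ->]].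
  by rewrite mul0r mulr_ge0 ?powR_ge0// ltW// (mu1_gt0 S).
rewrite -mulrA -powRD; last by rewrite (gt_eqF v0) implybT.
have -> : p - r + (r - 1) = p - 1 by ring.
by have /andP[_ ?] := scaling_range z v; rewrite ler_wpM2r ?powR_ge0.
Qed.

(** The reason for the [mu0] term in the step size: the exponents match through p (r - 1) + (p - r)
    = r (p - 1), and the result is the hypothesis of [young_descent] with [k] the step times
    [|v| ^ r]. *)
Lemma step_norm_le di i z (v : Y i) : 0 <= di -> B z ->
  (step di z v * dual_norm (direction z v)) `^ p <=
  mu0 * (step di z v * `|v| `^ r) `^ (p - 1).
Proof.
move=> di0 Bz; set G := dual_norm _; set t := step _ _ _.
have G0 : 0 <= G by apply: dual_norm_ge0; exact: direction_dual.
have t0 : 0 <= t by exact: step_ge0.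
have := step_cases z v di0; rewrite -/t => -[->|[v0 _ tE]].
  by rewrite !mul0r !powR0 ?gt_eqF// mulr0.
set s := sgd_scaling _ _ _ _ _ _ _ _ in tE.
have sG : s * G `^ p <= mu0 * `|v| `^ (p * (r - 1)).
  rewrite /s /sgd_scaling -/G; case: ifPn => [/eqP ->|Gn0].
    by rewrite powR0 ?gt_eqF// mulr0 mulr_ge0 ?powR_ge0// ltW// (mu0_gt0 S).
  have Gp : 0 < G `^ p by rewrite powR_gt0// lt_neqAle eq_sym Gn0.
  by rewrite -ler_pdivlMr// ge_min lexx.
have -> : (t * G) `^ p = t `^ (p - 1) * (t * G `^ p).
  by rewrite powRM// -(mulr_powRB1 t0 p_gt0); ring.
have -> : mu0 * (t * `|v| `^ r) `^ (p - 1) =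
    t `^ (p - 1) * (mu0 * `|v| `^ (r * (p - 1))).
  by rewrite powRM ?powR_ge0// -powRrM; ring.
rewrite ler_wpM2l ?powR_ge0// {1}tE mulrAC.
apply: (le_trans (ler_wpM2r (powR_ge0 _ _) sG)).
rewrite -mulrA -powRD; last by rewrite (gt_eqF v0) implybT.
by have -> : p * (r - 1) + (p - r) = r * (p - 1) by ring.
Qed.

(** The linearization at [z - xh] is the noisy residual [v] up to the cone error, at most
    [eta * (|v| + di)], and the noise, at most [di]. When the step is nonzero the switch gives
    [di < |v| / tau], so the error is at most [(eta + (1 + eta) / tau) * |v|]. *)
Lemma step_pairing_ge (di : R) i (z xh : X) (yn : Y i) : 0 <= di -> `|yn - y i| <= di ->
  B z -> B xh -> F i xh = y i ->
  (1 - eta - (1 + eta) / tau) * (step di z (F i z - yn) * `|F i z - yn| `^ r) <=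
  step di z (F i z - yn) * direction z (F i z - yn) (z - xh).
Proof.
move=> di0 yny Bz Bxh Fxh; set v := F i z - yn.
have t0 : 0 <= step di z v by exact: step_ge0.
have := step_cases z v di0; case=> [->|[v0 tv _]]; first by rewrite !mul0r mulr0.
rewrite mulrCA ler_wpM2l//.
have [dJ nJ Jv] := J_duality S v.
rewrite /sgd_direction /adjoint/=.
have H := tangential_cone S i Bxh Bz.
have zE : dF i z (z - xh) = v + ((F i xh - F i z - dF i z (xh - z)) + (yn - y i)).
  rewrite -[z - xh]opprB -[- (xh - z)]scaleN1r (bounded_opZ _ _ (dF_bounded i Bz)).
  rewrite scaleN1r Fxh /v; set a := dF i z _; set b := F i z.
  by rewrite [_ + (yn - _)]addrC addrA subrKA addrA subrKA subrr sub0r.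
have Jz : J v (dF i z (z - xh)) =
    `|v| `^ r + J v (F i xh - F i z - dF i z (xh - z) + (yn - y i)).
  by rewrite zE (dualD _ _ dJ) Jv.
have di_v : di <= `|v| / tau by rewrite ler_pdivlMr// mulrC ltW.
have Fv : `|F i xh - F i z| <= `|v| + di.
  have -> : F i xh - F i z = - v + - (yn - y i).
    by rewrite Fxh -opprD /v subrKA opprB.
  by rewrite (le_trans (ler_normD _ _))// !normrN lerD2l.
have e_le : `|F i xh - F i z - dF i z (xh - z) + (yn - y i)| <=
    (eta + (1 + eta) / tau) * `|v|.
  rewrite (le_trans (ler_normD _ _))//.
  have : eta * `|F i xh - F i z| <= eta * (`|v| + di) by rewrite ler_wpM2l.
  have : (1 + eta) * di <= (1 + eta) * (`|v| / tau) by rewrite ler_wpM2l// addr_ge0.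
  rewrite mulrCA mulrA [`|v| * _]mulrC -mulrA => ??; lra.
have := le_trans (ler_norm _) (le_dual_norm (- (F i xh - F i z - dF i z (xh - z) + (yn - y i))) dJ).
rewrite (dualN _ dJ) normrN nJ => JP.
have := le_trans JP (ler_wpM2l (powR_ge0 _ _) e_le).
rewrite Jz mulrCA [_ `^ _ * `|v|]mulrC mulr_powRB1//; lra.
Qed.

(** With [t] the step and [g] the direction, the three-point identity writes the change of the
    distance as [- D zeta z' z - t * g (z - xh) + t * g (z - z')]. The middle term is the gain;
    Young's inequality bounds the last one by [sigma * |z' - z| ^ p], absorbed by the first, plus
    the last term of [c0]. *)
Lemma bregman_step_decrease di i (z z' xh : X) (yn : Y i) (zeta zeta' : X -> R) :
  0 <= di -> `|yn - y i| <= di ->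
  subgradient theta z zeta -> subgradient theta z' zeta' ->
  (zeta' = fun h => zeta h - step di z (F i z - yn) * direction z (F i z - yn) h) ->
  B z -> B xh -> F i xh = y i -> eff_dom theta xh ->
  D zeta' xh z' + c0 * (step di z (F i z - yn) * `|F i z - yn| `^ r) <= D zeta xh z.
Proof.
move=> di0 yny sz sz' zeta'E Bz Bxh Fxh exh.
have pairing := step_pairing_ge di0 yny Bz Bxh Fxh.
have := step_norm_le (F i z - yn) di0 Bz.
set v := F i z - yn in zeta'E pairing *; set t := step _ _ _ in zeta'E pairing *.
set g := direction z v in zeta'E pairing *.
have dg : dual g by exact: direction_dual.
have t0 : 0 <= t by exact: step_ge0.
have [_ [dz _]] := sz.
have tG0 : 0 <= t * dual_norm g by rewrite mulr_ge0// dual_norm_ge0.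
have k0 : 0 <= t * `|v| `^ r by rewrite mulr_ge0 ?powR_ge0.
move=> /(young_descent (p_ge2 S) (sigma_gt0 S) (ltW (mu0_gt0 S)) (normr_ge0 (z' - z)) tG0 k0).
have := bregman_real_ge (theta_proper S) (theta_bregman S) sz sz'.1.
have gz : t * g (z - z') <= t * dual_norm g * `|z' - z|.
  rewrite -mulrA ler_wpM2l// distrC; apply: le_trans (le_dual_norm _ dg).
  exact: ler_norm.
set c := (p - 1) / p * _.
set s := `|z' - z| `^ p => breg young.
move: pairing gz breg; rewrite /bregman_real zeta'E !(dualB _ _ dz) !(dualB _ _ dg).
move=> ???; lra.
Qed.

(** For exact data a nonzero residual always triggers a step, and [direction_norm_le] bounds the
    scaling from below independently of [z] and [v]. *)
Lemma exact_step_residual i z (v : Y i) : B z ->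
  Num.min (mu0 / B0 `^ p) mu1 * `|v| `^ p <= step 0 z v * `|v| `^ r.
Proof.
move=> Bz; have [->|v0] := eqVneq v 0.
  by rewrite normr0 powR0 ?gt_eqF// mulr0 mulr_ge0 ?powR_ge0 ?step_ge0.
have nv0 : 0 < `|v| by rewrite normr_gt0.
rewrite /sgd_step mulr0 nv0 -mulrA -powRD; last by rewrite (gt_eqF nv0) implybT.
rewrite subrK ler_wpM2r ?powR_ge0//.
rewrite /sgd_scaling; case: ifPn => [_|G0]; first by rewrite ge_min lexx orbT.
rewrite le_min !ge_min lexx !orbT andbT; apply/orP; left.
set G := dual_norm _ in G0 *.
have Gge0 : 0 <= G by apply: dual_norm_ge0; exact: direction_dual.
have Gp : 0 < G `^ p by rewrite powR_gt0// lt_neqAle eq_sym G0.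
have Bp : 0 < B0 `^ p by rewrite powR_gt0// (B0_gt0 S).
rewrite ler_pdivlMr// mulrAC ler_pdivrMr// -mulrA ler_wpM2l//.
  by rewrite ltW// (mu0_gt0 S).
have := direction_norm_le v Bz; rewrite -/G => GB.
rewrite [p * _]mulrC powRrM mulrC -powRM ?powR_ge0// ?(ltW (B0_gt0 S))//.
apply: ge0_ler_powR; rewrite ?nnegrE ?(ltW p_gt0)//.
by rewrite mulr_ge0 ?powR_ge0// ltW// (B0_gt0 S).
Qed.

Definition noise_bound dl yn := forall i, `|yn i - y i| <= dl i.

Lemma noise_bound_ge0 dl yn i : noise_bound dl yn -> 0 <= dl i.
Proof. by move=> /(_ i); apply: le_trans. Qed.

Definition ball_solution xh := [/\ solution domF F y xh, B xh & eff_dom theta xh].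

Lemma ball_of_rho z : `|z - x0| <= rho -> B z.
Proof.
move=> zx0; rewrite /closed_ball_/= distrC (le_trans zx0)//.
by rewrite ler_peMl ?ler1n// ltW// (rho_gt0 S).
Qed.

Lemma ball_of_rho2 u z : `|u - x0| <= rho -> `|u - z| <= rho -> B z.
Proof.
move=> ux0 uz; rewrite /closed_ball_/= -(subrKA u) (le_trans (ler_normD _ _))//.
by rewrite mulr_natl mulr2n lerD// distrC.
Qed.

Lemma le_rho_of_bregman z zeta xh : subgradient theta z zeta -> eff_dom theta xh ->
  D zeta xh z <= sigma * rho `^ p -> `|xh - z| <= rho.
Proof.
move=> sz exh; have := bregman_real_ge (theta_proper S) (theta_bregman S) sz exh.
move=> /le_trans H /H; rewrite ler_pM2l ?(sigma_gt0 S)//.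
rewrite !leNgt; apply: contra => lt_rho.
by apply: gt0_ltr_powR => //; rewrite nnegrE// ltW// (rho_gt0 S).
Qed.

Lemma start_solution : exists xs, [/\ ball_solution xs,
  D xi0 xs x0 <= sigma * rho `^ p & `|xs - x0| <= rho].
Proof.
have [xs [solxs exs Dxs]] := near_solution S; exists xs.
have sx0 := start_subgradient S.
move: Dxs; rewrite (bregmanE (theta_proper S) _ exs sx0.1) lee_fin => Dxs.
have xs_rho := le_rho_of_bregman sx0 exs Dxs.
by split=> //; split=> //; exact: ball_of_rho.
Qed.

(** Minimality puts [xd] no farther from [x0], in Bregman distance, than the solution assumed near
    [x0]. *)
Lemma minimal_solution_ball xd :
  bregman_minimal_solution domF F y theta xi0 x0 xd -> ball_solution xd.
Proof.
move=> [solxd exd xdmin]; split=> //.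
have sx0 := start_subgradient S.
have [xs [[solxs _ exs] Dxs _]] := start_solution.
have := xdmin _ solxs exs.
rewrite !(bregmanE (theta_proper S) _ _ sx0.1)// lee_fin => /le_trans/(_ Dxs).
by move=> /(le_rho_of_bregman sx0 exd)/ball_of_rho.
Qed.

Lemma next_subgradient i (s : (X -> R) * X) dl yn : subgradient theta s.2 s.1 -> B s.2 ->
  subgradient theta (next dl yn i s).2 (next dl yn i s).1.
Proof.
move=> [es [ds _]] Bs.
have dz : dual (next dl yn i s).1 by apply: dual_comb => //; exact: direction_dual.
have := argmin_exists (p_ge2 S) (sigma_gt0 S) (theta_proper S) (theta_lsc S)
  (theta_p_convex S) (theta_bregman S) (start_subgradient S) dz.
move=> /(xgetPex x0); exact: (argmin_subgradient (theta_proper S)).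
Qed.

Lemma next_decrease i (s : (X -> R) * X) dl yn xh : noise_bound dl yn ->
  subgradient theta s.2 s.1 -> B s.2 -> ball_solution xh ->
  D (next dl yn i s).1 xh (next dl yn i s).2 +
    c0 * (step (dl i) s.2 (F i s.2 - yn i) * `|F i s.2 - yn i| `^ r) <= D s.1 xh s.2.
Proof.
move=> nb sub_s Bs [[_ solxh] Bxh exh].
apply: bregman_step_decrease => //; first exact: noise_bound_ge0 nb.
  exact: next_subgradient.
exact: solxh.
Qed.

Lemma next_decreases i (s : (X -> R) * X) dl yn xh : noise_bound dl yn ->
  subgradient theta s.2 s.1 -> B s.2 -> ball_solution xh ->
  D (next dl yn i s).1 xh (next dl yn i s).2 <= D s.1 xh s.2.
Proof.
move=> nb sub_s Bs solxh; apply: le_trans (next_decrease i nb sub_s Bs solxh).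
rewrite lerDl mulr_ge0 ?(ltW (c0_gt0 S))// mulr_ge0 ?powR_ge0//.
by rewrite step_ge0.
Qed.

(** The invariant of the induction is the Bregman distance to one fixed solution [xs]: it keeps the
    iterate within [rho] of [xs], which is itself within [rho] of [x0]; hence the radius
    [2 * rho]. *)
Lemma state_ball dl yn l : noise_bound dl yn ->
  subgradient theta (state dl yn l).2 (state dl yn l).1 /\ B (state dl yn l).2.
Proof.
move=> nb; have [xs [solxs Dxs xs_rho]] := start_solution.
suff [sub_s Ds] : subgradient theta (state dl yn l).2 (state dl yn l).1 /\
    D (state dl yn l).1 xs (state dl yn l).2 <= sigma * rho `^ p.
  have [_ _ exs] := solxs; split=> //.
  exact: ball_of_rho2 xs_rho (le_rho_of_bregman sub_s exs Ds).
elim: l => [|i l [sub_s Ds]]; first by split=> //; exact: start_subgradient S.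
have [_ _ exs] := solxs.
have Bs : B (state dl yn l).2.
  exact: ball_of_rho2 xs_rho (le_rho_of_bregman sub_s exs Ds).
split; first exact: next_subgradient.
by apply: le_trans Ds; exact: next_decreases.
Qed.

(** The given iterates are only specified as minimizers; uniqueness identifies them with a
    deterministic function of the drawn word. *)
Lemma iterates_state dl yn ind xi x : noise_bound dl yn ->
  sgd_iterates F dF J theta p r mu0 mu1 tau x0 xi0 dl yn ind xi x ->
  forall n, state dl yn (past ind n) = (xi n, x n).
Proof.
move=> nb [x0E xi0E step_eq]; elim=> [|n IH]; first by rewrite /= x0E xi0E.
have [sub_s Bs] := state_ball (past ind n) nb; have [xiE xP] := step_eq n.
have := next_subgradient (ind n) dl yn sub_s Bs.
rewrite IH.
have -> : (next dl yn (ind n) (xi n, x n)).1 = xi n.+1 by rewrite xiE.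
move=> sub1.
have -> : state dl yn (past ind n.+1) = next dl yn (ind n) (xi n, x n) by rewrite -IH.
rewrite [LHS]surjective_pairing; congr pair; first by rewrite xiE.
apply: (subgradient_unique (theta_proper S) (sigma_gt0 S) (theta_bregman S) sub1).
by apply: (argmin_subgradient (theta_proper S)) => //; have [_ []] := sub1.
Qed.

Lemma noise_bound0 : noise_bound (fun=> 0) y.
Proof. by move=> i; rewrite subrr normr0. Qed.

Definition residual l := \sum_(j < N) `|F j (exact l).2 - y j| `^ p.

Lemma residual_ge0 l : 0 <= residual l.
Proof. by apply: sumr_ge0 => j _; exact: powR_ge0. Qed.

Lemma residual_ge l j : `|F j (exact l).2 - y j| `^ p <= residual l.
Proof.
rewrite /residual (bigD1 j)//= lerDl; apply: sumr_ge0 => k _; exact: powR_ge0.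
Qed.

(** At a solution every step vanishes, so the dual variable and hence the unique minimizer are
    unchanged. *)
Lemma residual_stay l i : residual l = 0 -> residual (i :: l) = 0.
Proof.
move=> l0; have Fy j : F j (exact l).2 = y j.
  apply/eqP; rewrite -subr_eq0 -normr_eq0.
  have : `|F j (exact l).2 - y j| `^ p == 0.
    by rewrite eq_le powR_ge0 -[X in _ <= X]l0 residual_ge.
  by rewrite powR_eq0 => /andP[].
have [sub_l Bl] := state_ball l noise_bound0.
have [sub_il _] := state_ball (i :: l) noise_bound0.
have xi_il : (exact (i :: l)).1 = (exact l).1.
  rewrite /= Fy subrr /sgd_step mulr0 normr0 ltxx.
  by apply/funext => h; rewrite mul0r subr0.
rewrite -l0 /residual; rewrite xi_il in sub_il.
by rewrite (subgradient_unique (theta_proper S) (sigma_gt0 S) (theta_bregman S) sub_il sub_l).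
Qed.

(** Splitting [w - xh] at [z] turns both linearized differences into differences of values of [F i],
    bounded by residuals at [z] (twice) and at [w] (once). *)
Lemma direction_residual_le i z w xh : B z -> B w -> ball_solution xh ->
  step 0 z (F i z - y i) * `|direction z (F i z - y i) (w - xh)| <=
  mu1 * `|F i z - y i| `^ (p - 1) * ((1 + eta) * (2 * `|F i z - y i| + `|F i w - y i|)).
Proof.
move=> Bz Bw [[_ solxh] Bxh _]; set v := F i z - y i.
have [dJ nJ _] := J_duality S v.
have dz := dF_bounded i Bz.
have dF_wxh : `|dF i z (w - xh)| <= (1 + eta) * (2 * `|v| + `|F i w - y i|).
  have -> : w - xh = (w - z) - (xh - z) by rewrite opprB subrKA.
  rewrite (bounded_opB _ _ dz) (le_trans (ler_normB _ _))//.
  have H1 := dF_le_residual i Bw Bz; have H2 := dF_le_residual i Bxh Bz.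
  have e1 : 0 <= 1 + eta by rewrite addr_ge0.
  have : `|F i w - F i z| <= `|F i w - y i| + `|v|.
    by rewrite -(subrKA (y i)) (le_trans (ler_normD _ _))// lerD2l distrC.
  have : `|F i xh - F i z| = `|v| by rewrite solxh distrC.
  move: H2 => /[swap] ->; move=> H2 /(ler_wpM2l e1) H3; lra.
have Jle := le_dual_norm (dF i z (w - xh)) dJ; rewrite nJ in Jle.
have t0 : 0 <= step 0 z v by exact: step_ge0.
apply: (le_trans (ler_wpM2l t0 Jle)); rewrite [leLHS]mulrA.
apply: ler_pM => //; first by rewrite mulr_ge0 ?powR_ge0.
exact: step_le.
Qed.

(** * Convergence along one path with exact data *)

Section Path.
Variables (s : nat -> 'I_N) (xh : X).
Hypothesis xh_sol : ball_solution xh.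

Let x n := (exact (past s n)).2.
Let xi n := (exact (past s n)).1.

(* Summing these weights over [n <= m < k] bounds [D (xi n) (x k) (x n)] as soon as
   the residual at [k] is the lowest so far. *)
Definition cauchy_weight m :=
  D (xi m) xh (x m) - D (xi m.+1) xh (x m.+1) +
  3 * mu1 * (1 + eta) * residual (past s m).

Let sub_x n : subgradient theta (x n) (xi n).
Proof. by have [] := state_ball (past s n) noise_bound0. Qed.

Let B_x n : B (x n).
Proof. by have [] := state_ball (past s n) noise_bound0. Qed.

Let C_ge0 : 0 < 3 * mu1 * (1 + eta).
Proof. by rewrite !mulr_gt0 ?(mu1_gt0 S) ?ltr_pwDl. Qed.

Lemma residual_le_weight m : 3 * mu1 * (1 + eta) * residual (past s m) <= cauchy_weight m.
Proof.
rewrite lerDr subr_ge0; exact: (next_decreases (s m) noise_bound0 (sub_x m) (B_x m) xh_sol).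
Qed.

Lemma cauchy_weight_ge0 m : 0 <= cauchy_weight m.
Proof.
by apply: le_trans (residual_le_weight m); rewrite mulr_ge0 ?residual_ge0// ltW.
Qed.

(** With [h := x k - xh], the distance equals [D (xi n) xh (x n) - D (xi k) xh (x k) + (xi k h - xi
    n h)], which telescopes. Each increment of [xi] at [h] involves residuals at [m] and [k], and
    the record property replaces the latter by the former. *)
Lemma exact_cauchy n k : (n <= k)%N ->
  (forall m, (m < k)%N -> residual (past s k) <= residual (past s m)) ->
  D (xi n) (x k) (x n) <= \sum_(n <= m < k) cauchy_weight m.
Proof.
move=> nk low; set h := x k - xh.
have dxi m : dual (xi m) by have [_ []] := sub_x m.
have -> : D (xi n) (x k) (x n) =
    \sum_(n <= m < k) (D (xi m) xh (x m) - D (xi m.+1) xh (x m.+1) + (xi m.+1 h - xi m h)).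
  rewrite big_split/= (telescope_sumr (fun m => xi m h))//.
  have -> : \sum_(n <= m < k) (D (xi m) xh (x m) - D (xi m.+1) xh (x m.+1)) =
      - (D (xi k) xh (x k) - D (xi n) xh (x n)).
    rewrite -(telescope_sumr (fun m => D (xi m) xh (x m)))// -sumrN.
    by apply: eq_bigr => m _; rewrite opprB.
  rewrite /bregman_real /h !(dualB _ _ (dxi n)) !(dualB _ _ (dxi k)); ring.
rewrite !big_nat; apply: ler_sum => m /andP[_ mk]; rewrite lerD2l.
have -> : xi m.+1 h - xi m h = - (step 0 (x m) (F (s m) (x m) - y (s m)) *
    direction (x m) (F (s m) (x m) - y (s m)) h).
  by rewrite /xi/= addrAC subrr sub0r.
apply: (le_trans (ler_norm _)); rewrite normrN normrM ger0_norm ?step_ge0//.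
apply: (le_trans (direction_residual_le (s m) (B_x m) (B_x k) xh_sol)).
set a := `|F (s m) (x m) - y (s m)|; set b := `|F (s m) (x k) - y (s m)|.
have ap : a `^ p <= residual (past s m) by exact: residual_ge.
have bp : b `^ p <= residual (past s m) by apply: le_trans (low _ mk); exact: residual_ge.
have p1 : 1 <= p by have := p_ge2 S; lra.
have aa := powR_mul_le p1 (normr_ge0 _) (normr_ge0 _) ap ap; rewrite -/a in aa.
have ab := powR_mul_le p1 (normr_ge0 _) (normr_ge0 _) ap bp; rewrite -/a -/b in ab.
(* Two residuals at [m] and one at [k], each product bounded by the total residual at [m]: this is
   the factor 3 in [cauchy_weight]. *)
have -> : mu1 * a `^ (p - 1) * ((1 + eta) * (2 * a + b)) =
  mu1 * (1 + eta) * (2 * (a `^ (p - 1) * a) + a `^ (p - 1) * b) by ring.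
have m1 : 0 <= mu1 * (1 + eta) by rewrite mulr_ge0 ?addr_ge0// ltW// (mu1_gt0 S).
have := ler_wpM2l m1 aa; have := ler_wpM2l m1 ab; lra.
Qed.

Hypothesis summable_weight : (\sum_(0 <= m <oo) (cauchy_weight m)%:E < +oo)%E.

Let tail n : \bar R := (\sum_(n <= m <oo) (cauchy_weight m)%:E)%E.

Let weight_ge0 m : (0 <= (cauchy_weight m)%:E)%E.
Proof. by rewrite lee_fin cauchy_weight_ge0. Qed.

Let tail_fin n : tail n = (fine (tail n))%:E.
Proof.
rewrite fineK// ge0_fin_numE; last by apply: nneseries_ge0.
apply: le_lt_trans summable_weight.
rewrite (nneseries_split 0 n)// add0n leeDr//.
by apply: sume_ge0 => i _; exact: weight_ge0.
Qed.

Let tail_cvg : fine (tail n) @[n --> \oo] --> 0.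
Proof.
have /= := nneseries_tail_cvg summable_weight (fun k _ => weight_ge0 k).
by move=> /fine_cvgP[].
Qed.

Let le_tail n k : \sum_(n <= m < k) cauchy_weight m <= fine (tail n).
Proof.
rewrite -lee_fin -tail_fin -sumEFin.
exact: (nneseries_lim_ge (u_ := fun m => (cauchy_weight m)%:E)).
Qed.

Lemma exact_path_cvg : exists xstar, [/\ ball_solution xstar,
   x @ \oo --> xstar &
   forall n, ((D (xi n) xstar (x n))%:E <= \sum_(n <= m <oo) (cauchy_weight m)%:E)%E].
Proof.
have weight_tail m : cauchy_weight m <= fine (tail m).
  by have := le_tail m m.+1; rewrite big_nat1.
have res_cvg : residual (past s n) @[n --> \oo] --> 0.
  apply: (@squeeze_cvgr _ _ _ _ (fun=> 0) (fun n => (3 * mu1 * (1 + eta))^-1 * fine (tail n))).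
  - apply: nearW => n; rewrite residual_ge0/= ler_pdivlMl//.
    exact: le_trans (residual_le_weight n) (weight_tail n).
  - exact: cvg_cst.
  - by rewrite -(mulr0 (3 * mu1 * (1 + eta))^-1); apply: cvgMl_tmp; exact: tail_cvg.
have [kap kapP] : {kap : nat -> nat & forall n, (n <= kap n)%N /\
    forall m, (m < kap n)%N -> residual (past s (kap n)) <= residual (past s m)}.
  apply: (@choice _ _ (fun n k => (n <= k)%N /\
    forall m, (m < k)%N -> residual (past s k) <= residual (past s m))) => n.
  have [k nk kP] := record_low (fun n => residual_ge0 (past s n)) res_cvg
    (fun m => residual_stay (s m)) n.
  by exists k.
have kap_oo : kap @ \oo --> \oo.
  by move=> A [M _ MA]; exists M => // n /= Mn; apply: MA; exact: leq_trans Mn (kapP n).1.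
have sg0 := sigma_gt0 S.
have low_le n j : (n <= kap j)%N -> D (xi n) (x (kap j)) (x n) <= fine (tail n).
  move=> nk; apply: le_trans (le_tail n (kap j)).
  by apply: exact_cauchy => //; exact: (kapP j).2.
have tail_ge0 n : 0 <= fine (tail n).
  by apply: fine_ge0; apply: nneseries_ge0.
have dist_le n j : (n <= kap j)%N -> sigma * `|x (kap j) - x n| `^ p <= fine (tail n).
  move=> nk; apply: le_trans (low_le _ _ nk).
  exact: (bregman_real_ge (theta_proper S) (theta_bregman S) (sub_x n) (sub_x (kap j)).1).
have tail_kap : fine (tail (kap n)) @[n --> \oo] --> 0.
  exact: cvg_comp kap_oo tail_cvg.
have cx : cvg (x \o kap @ \oo).
  apply: (cvg_of_powR_cauchy sg0 p_gt0 tail_kap) => n m /=.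
  have [/dist_le H|/ltnW/dist_le H] := leqP (kap n) (kap m).
    by rewrite distrC; apply: (le_trans H); rewrite lerDl.
  by apply: (le_trans H); rewrite lerDr.
pose xs := lim (x \o kap @ \oo).
have x_xs : x (kap n) @[n --> \oo] --> xs by [].
have xsB : B xs.
  have H : `|x0 - x (kap n)| @[n --> \oo] --> `|x0 - xs|.
    by apply: cvg_norm; apply: cvgB => //; exact: cvg_cst.
  rewrite /closed_ball_/= -(cvg_lim _ H)//; apply: limr_le; first exact: cvgP H.
  by apply: nearW => n; exact: B_x.
(* For fixed [n], lower semicontinuity passes the bound [low_le] to the limit in [j]. It holds for
   all [n], not only for record times, and also shows that [theta xs] is finite. *)
have tail_bound n : (theta xs <= (fine (theta (x n)) + xi n (xs - x n) + fine (tail n))%:E)%E.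
  have [_ [_ cxi]] : dual (xi n) /\ dual (xi n) by have [_ []] := sub_x n.
  apply: (lsc_le (theta_proper S) (theta_lsc S) x_xs
     (b := fun j => fine (theta (x n)) + xi n (x (kap j) - x n) + fine (tail n))).
    apply: cvgD; last exact: cvg_cst.
    apply: cvgD; first exact: cvg_cst.
    apply: (@continuous_cvg _ _ _ _ _ _ (xi n : X -> R^o)); first exact: cxi.
    by apply: cvgB => //; exact: cvg_cst.
  near=> j.
  have nk : (n <= kap j)%N by apply: leq_trans (kapP j).1; near: j; exact: nbhs_infty_ge.
  rewrite (eff_domE (theta_proper S) (sub_x (kap j)).1) lee_fin.
  have := low_le _ _ nk; rewrite /bregman_real; lra.
have exs : eff_dom theta xs := eff_dom_fin (tail_bound 0%N).
have D_xs n : D (xi n) xs (x n) <= fine (tail n).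
  have := tail_bound n; rewrite (eff_domE (theta_proper S) exs) lee_fin /bregman_real; lra.
exists xs; split.
- split=> //; split; first exact: (ball_dom S xsB).
  move=> j; apply/eqP; rewrite -subr_eq0 -normr_le0; apply/ler_addgt0Pl => e e0.
  rewrite addr0.
  have eta1 : 0 < 1 - eta by rewrite subr_gt0; have /andP[] := eta_range S.
  have e1 : 0 < (1 - eta) * (e / 2) / B0 by rewrite divr_gt0 ?mulr_gt0 ?divr_gt0 ?(B0_gt0 S).
  have e2 : 0 < (e / 2) `^ p by rewrite powR_gt0// divr_gt0.
  have res_kap : residual (past s (kap n)) @[n --> \oo] --> 0.
    exact: cvg_comp kap_oo res_cvg.
  suff : \forall n \near \oo, `|F j xs - y j| <= e by case/filter_ex.
  near=> n.
  have H1 : `|xs - x (kap n)| <= (1 - eta) * (e / 2) / B0.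
    by near: n; move/cvgrPdist_le: x_xs; exact.
  have H2 : residual (past s (kap n)) < (e / 2) `^ p.
    by near: n; exact: (cvgr_lt 0 res_kap).
  have H3 : `|F j (x (kap n)) - y j| <= e / 2.
    apply/ltW/(ltr_powR_inv p_gt0) => //; first by rewrite divr_ge0// ltW.
    by apply: le_lt_trans H2; exact: residual_ge.
  have H4 : `|F j xs - F j (x (kap n))| <= e / 2.
    rewrite -(ler_pM2l eta1) (le_trans (F_lipschitz j xsB (B_x (kap n))))//.
    by rewrite mulrC -ler_pdivlMr// (B0_gt0 S).
  by rewrite -(subrKA (F j (x (kap n)))) (le_trans (ler_normD _ _))// [e]splitr lerD.
(* The whole sequence converges, because the bound by the tail holds at every [n]. *)
- apply: (cvg_of_powR_le sg0 p_gt0 tail_cvg) => n; apply: le_trans (D_xs n).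
  exact: (bregman_real_ge (theta_proper S) (theta_bregman S) (sub_x n) exs).
- by move=> n; rewrite -/(tail n) tail_fin lee_fin.
Unshelve. all: by end_near.
Qed.

(* [xi n - xi0] vanishes on the common null space of the [dF i xd], hence at
   [xstar - xd], so [D (xi n) xstar (x n) - D (xi n) xd (x n)] does not depend on [n]. *)
Lemma exact_path_minimal xd xstar :
  bregman_minimal_solution domF F y theta xi0 x0 xd ->
  (forall i z, B z -> nullspace (dF i xd) `<=` nullspace (dF i z)) ->
  ball_solution xstar ->
  x @ \oo --> xstar ->
  (forall n, ((D (xi n) xstar (x n))%:E <= \sum_(n <= m <oo) (cauchy_weight m)%:E)%E) ->
  xstar = xd.
Proof.
move=> xd_min null [solxs Bxs exs] xxs Dxs.
have [[_ solxd] exd xdmin] := xd_min; have [_ Bxd _] := minimal_solution_ball xd_min.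
have sx0 := start_subgradient S.
have D0le : D xi0 xd x0 <= D xi0 xstar x0.
  have := xdmin _ solxs exs.
  by rewrite !(bregmanE (theta_proper S) _ _ sx0.1)// lee_fin.
(* By the cone condition, solutions differ by an element of the null space. *)
have null_diff i : dF i xd (xstar - xd) = 0.
  apply/eqP; rewrite -normr_eq0 eq_le normr_ge0 andbT.
  apply: le_trans (dF_le_residual i Bxs Bxd) _.
  by rewrite solxs.2 solxd subrr normr0 mulr0.
have xi_diff n : xi n (xstar - xd) = xi0 (xstar - xd).
  elim: n => [//|n IH]; rewrite -IH /xi/= -/(xi n) /sgd_direction /adjoint/=.
  rewrite (null (s n) _ (B_x n) _ (null_diff (s n))).
  have [dJ _ _] := J_duality S (F (s n) (x n) - y (s n)).
  by rewrite (dual0 dJ) mulr0 subr0.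
(* Minimality orders the two distances at [xi0], and by [xi_diff] the order persists at every
   [xi n]. So the iterates converge to [xd] as well. *)
have D_le n : D (xi n) xd (x n) <= fine (tail n).
  apply: (@le_trans _ _ (D (xi n) xstar (x n))); last first.
    by rewrite -lee_fin -tail_fin; exact: Dxs.
  have dxi : dual (xi n) by have [_ []] := sub_x n.
  have [_ [dxi0 _]] := sx0.
  have := xi_diff n; move: D0le; rewrite /bregman_real !(dualB _ _ dxi) !(dualB _ _ dxi0).
  lra.
apply/esym/(cvg_unique _ _ xxs) => //.
apply: (cvg_of_powR_le (sigma_gt0 S) p_gt0 tail_cvg) => n; apply: le_trans (D_le n).
exact: (bregman_real_ge (theta_proper S) (theta_bregman S) (sub_x n) exd).
Qed.

End Path.

(** * Continuous dependence of finitely many steps on the data *)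

Section Stability.
Context {T : Type} (Fl : set_system T) {FFl : Filter Fl}.
Variables (dl : T -> 'I_N -> R) (yn : T -> forall i, Y i).
Hypothesis yn_bound : \forall a \near Fl, noise_bound (dl a) (yn a).
Hypothesis dl_cvg : forall i, dl a i @[a --> Fl] --> 0.

Lemma cvg_subgradient (z_ : T -> X) (zeta_ : T -> X -> R) z zeta :
  (\forall a \near Fl, subgradient theta (z_ a) (zeta_ a)) ->
  subgradient theta z zeta -> dual_cvg Fl zeta_ zeta -> z_ @ Fl --> z.
Proof.
move=> sub_ sub_z zz; apply/cvgrPdist_lt => e e0.
have sg0 := sigma_gt0 S.
(* Against the [2 * sigma] of the Hölder estimate this leaves a factor 2, which makes the final
   inequality strict. *)
pose e1 := sigma * e `^ (p - 1).
have e10 : 0 < e1 by rewrite mulr_gt0 ?powR_gt0.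
move: (zz _ e10) sub_; apply: filterS2 => a za suba.
have := subgradient_lipschitz (p_ge2 S) (theta_proper S) (theta_bregman S)
  (ltW e10) suba sub_z za.
move=> H; rewrite distrC; apply: (ltr_powR_inv p1_gt0) => //; first exact: ltW.
rewrite -(ltr_pM2l sg0) -/e1.
have := mulr_ge0 (ltW sg0) (powR_ge0 `|z_ a - z| (p - 1)); move: H; rewrite -mulrA.
by set A := sigma * _ => *; lra.
Qed.

Section DirectionStability.
Variables (i : 'I_N) (z_ : T -> X) (z : X).
Hypothesis B_z_ : \forall a \near Fl, B (z_ a).
Hypothesis B_z : B z.
Hypothesis z_cvg : z_ @ Fl --> z.

Let v_ a := F i (z_ a) - yn a i.
Let v := F i z - y i.

Let v_cvg : v_ @ Fl --> v.
Proof.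
have eta1 : 0 < 1 - eta by rewrite subr_gt0; have /andP[] := eta_range S.
apply: cvgB; apply/cvgrPdist_le => e e0.
  have e1 : 0 < (1 - eta) * e / B0 by rewrite divr_gt0 ?mulr_gt0 ?(B0_gt0 S).
  move/cvgrPdist_le/(_ _ e1): z_cvg; move: B_z_; apply: filterS2 => a Ba H.
  rewrite -(ler_pM2l eta1) (le_trans (F_lipschitz i B_z Ba))//.
  by rewrite mulrC -ler_pdivlMr// (B0_gt0 S).
move/cvgrPdist_le/(_ _ e0): (dl_cvg i); move: yn_bound; apply: filterS2 => a Ba.
rewrite sub0r normrN distrC => /(le_trans (ler_norm _)).
exact: le_trans (Ba i).
Qed.

Let dF_near e : 0 < e ->
  \forall a \near Fl, forall h, `|dF i (z_ a) h - dF i z h| <= e * `|h|.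
Proof.
move=> e0; have := dF_continuous S i B_z.
move/cvgrPdist_le/(_ _ e0); rewrite near_withinE => /z_cvg.
move: B_z_; apply: filterS2 => a Ba /(_ Ba) H h.
have bop := bounded_operatorB (dF_bounded i Ba) (dF_bounded i B_z).
apply: (le_trans (le_opnorm h bop)); rewrite ler_wpM2r//.
by move: H; rewrite sub0r normrN; apply: le_trans; exact: ler_norm.
Qed.

Let direction_cvg : v != 0 ->
  dual_cvg Fl (fun a => direction (z_ a) (v_ a)) (direction z v).
Proof.
move=> v0 e e0; have B0p := B0_gt0 S.
have [dJ nJ _] := J_duality S v.
have NJ := dual_norm_ge0 dJ.
have e1 : 0 < e / 2 / B0 by rewrite !divr_gt0.
have N1 : 0 < dual_norm (J v) + 1 by rewrite ltr_wpDl.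
have e2 : 0 < e / 2 / (dual_norm (J v) + 1) by rewrite !divr_gt0.
have Jc := @cvg_duality_mapping _ _ _ Fl FFl r (@J i) v_ v (Y_smooth S i)
  (r_gt1 S) (@J_duality _ _ _ _ _ _ _ _ _ _ _ _ _ _ _ _ _ _ _ _ _ S i) v0 v_cvg _ e1.
have dFc := dF_near e2.
near=> a => h; rewrite /sgd_direction /adjoint/=.
have Ba : B (z_ a) by near: a.
have -> : J (v_ a) (dF i (z_ a) h) - J v (dF i z h) =
   (J (v_ a) (dF i (z_ a) h) - J v (dF i (z_ a) h)) + J v (dF i (z_ a) h - dF i z h).
  by rewrite (dualB _ _ dJ); ring.
have -> : e * `|h| = e / 2 * `|h| + e / 2 * `|h| by field.
rewrite (le_trans (ler_normD _ _))// lerD//.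
  have : `|J (v_ a) (dF i (z_ a) h) - J v (dF i (z_ a) h)| <= e / 2 / B0 * `|dF i (z_ a) h|.
    by move: (dF i _ h) => k; move: k; near: a.
  move/le_trans; apply.
  rewrite -mulrA ler_wpM2l//; first by rewrite divr_ge0// ltW.
  by rewrite ler_pdivrMl// dF_le.
apply: le_trans (le_dual_norm _ dJ) _.
have : `|dF i (z_ a) h - dF i z h| <= e / 2 / (dual_norm (J v) + 1) * `|h|.
  by move: h; near: a.
move/(ler_wpM2l NJ)/le_trans; apply.
rewrite mulrA ler_wpM2r// mulrCA ler_piMr ?divr_ge0 ?(ltW e0)//.
by rewrite ler_pdivrMr// mul1r lerDl.
Unshelve. all: by end_near.
Qed.

Lemma step_direction_cvg :
  dual_cvg Fl (fun a h => step (dl a i) (z_ a) (v_ a) * direction (z_ a) (v_ a) h)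
    (fun h => step 0 z v * direction z v h).
Proof.
have B0p := B0_gt0 S; have m1 := mu1_gt0 S.
have dl_ge0 : \forall a \near Fl, 0 <= dl a i.
  by apply: filterS yn_bound => a /noise_bound_ge0.
(* The switch [tau * dl < |v_|] is discontinuous where [v = 0], but there the step
   has size [O(|v_| ^ (p - 1))]. *)
have [v0|v0] := eqVneq v 0.
  move=> e e0; pose k := (e / (mu1 * B0)) `^ (p - 1)^-1.
  have eB : 0 < e / (mu1 * B0) by rewrite divr_gt0 ?mulr_gt0.
  have k0 : 0 < k by rewrite powR_gt0.
  have : \forall a \near Fl, `|v_ a| <= k.
    have v_cvg0 : v_ @ Fl --> (0 : Y i) by rewrite -v0; exact: v_cvg.
    exact: cvgr0_norm_le v_cvg0 _ k0.
  move: dl_ge0 B_z_; apply: filterS3 => a d0 Ba vk h.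
  rewrite v0 /sgd_step mulr0 normr0 ltxx mul0r subr0 -/(step (dl a i) (z_ a) (v_ a)).
  have dg := direction_dual (v_ a) Ba.
  have t0 : 0 <= step (dl a i) (z_ a) (v_ a) by exact: step_ge0.
  rewrite normrM ger0_norm//; apply: le_trans (ler_wpM2l t0 (le_dual_norm h dg)) _.
  rewrite mulrA ler_wpM2r//.
  apply: le_trans (ler_wpM2l t0 (direction_norm_le (v_ a) Ba)) _.
  rewrite mulrCA; apply: le_trans (ler_wpM2l (ltW B0p) (step_le (z_ a) (v_ a) d0)) _.
  have vp : `|v_ a| `^ (p - 1) <= e / (mu1 * B0).
    have <- : k `^ (p - 1) = e / (mu1 * B0).
      by rewrite -powRrM mulVf ?gt_eqF// powRr1// ltW.
    by apply: ge0_ler_powR; rewrite ?nnegrE ?(ltW p1_gt0) ?(ltW k0).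
  rewrite mulrA [B0 * _]mulrC; move: vp; rewrite ler_pdivlMr ?mulr_gt0//.
  by rewrite [X in X <= e -> _]mulrC.
apply: dual_cvgZ (direction_cvg v0) => //; first exact: direction_dual.
have nv0 : 0 < `|v| by rewrite normr_gt0.
have [xs [[[_ solxs] Bxs exs] _ _]] := start_solution.
pose G := dual_norm (direction z v).
have dg := direction_dual v B_z.
have G_ge0 : 0 <= G by exact: dual_norm_ge0.
(* The scaling switches branch where the direction vanishes. This cannot happen at a nonzero exact
   residual: the pairing with [z - xs] would be both positive and 0. *)
have G0 : 0 < G.
  rewrite lt_neqAle G_ge0 andbT eq_sym; apply/negP => /eqP G0.
  have yy : `|y i - y i| <= 0 by rewrite subrr normr0.
  have := step_pairing_ge (lexx 0) yy B_z Bxs (solxs i); rewrite -/v.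
  have := le_dual_norm (z - xs) dg; rewrite -/G G0 mul0r => /(le_trans (ler_norm _)).
  have : 0 < step 0 z v.
    rewrite /sgd_step mulr0 nv0 mulr_gt0 ?powR_gt0// /sgd_scaling -/G G0 eqxx//.
  set t := step _ _ _ => t0 gz.
  apply/negP; rewrite -ltNge (@le_lt_trans _ _ 0)//; first by rewrite mulr_ge0_le0// ltW.
  rewrite !mulr_gt0 ?powR_gt0//; have := c0_gt0 S; move/lt_le_trans; apply.
  rewrite gerBl mulr_ge0 ?powR_ge0// divr_ge0// ltW//.
have nv_cvg : `|v_ a| @[a --> Fl] --> `|v| by exact: cvg_norm.
have G_cvg : dual_norm (direction (z_ a) (v_ a)) @[a --> Fl] --> G.
  apply/cvgrPdist_le => e e0; have := direction_cvg v0 e0.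
  move: B_z_; apply: filterS2 => a Ba H; rewrite distrC.
  apply: dual_norm_sub_le (ltW e0) H => //; exact: direction_dual.
have lim : Num.min (mu0 * `|v_ a| `^ (p * (r - 1)) /
      dual_norm (direction (z_ a) (v_ a)) `^ p) mu1 * `|v_ a| `^ (p - r) @[a --> Fl] -->
    Num.min (mu0 * `|v| `^ (p * (r - 1)) / G `^ p) mu1 * `|v| `^ (p - r).
  apply: cvgM; last exact: cvg_powR.
  apply: cvg_minr; last exact: cvg_cst.
  apply: cvgM.
    apply: cvgM; [exact: cvg_cst|exact: cvg_powR].
  by apply: cvgV; [rewrite gt_eqF// powR_gt0|exact: cvg_powR].
have -> : step 0 z v = Num.min (mu0 * `|v| `^ (p * (r - 1)) / G `^ p) mu1 * `|v| `^ (p - r).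
  by rewrite /sgd_step mulr0 nv0 /sgd_scaling -/G gt_eqF.
apply: cvg_trans lim; apply: near_eq_cvg.
near=> a.
(* Eventually [tau * dl] is below [|v| / 2] and [|v_ a|] above it, so the step is active. *)
rewrite /sgd_step /sgd_scaling ifT; last first.
  apply: (@lt_trans _ _ (`|v| / 2)).
    near: a; apply: (cvgr_lt (tau * 0)); last by rewrite mulr0 divr_gt0.
    by apply: cvgM; [exact: cvg_cst|exact: dl_cvg].
  near: a; apply: (cvgr_gt `|v|) => //.
  by rewrite ltr_pdivrMr// ltr_pMr// ltr1n.
rewrite ifF// gt_eqF//.
near: a; exact: (cvgr_gt G G_cvg).
Unshelve. all: by end_near.
Qed.

End DirectionStability.

(** The dual variables converge by [step_direction_cvg]; the primal ones follow by
    [cvg_subgradient], and both feed the next step. *)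
Lemma state_cvg l :
  dual_cvg Fl (fun a => (state (dl a) (yn a) l).1) (state (fun=> 0) y l).1 /\
  (state (dl a) (yn a) l).2 @[a --> Fl] --> (state (fun=> 0) y l).2.
Proof.
have sub_ k : \forall a \near Fl,
    subgradient theta (state (dl a) (yn a) k).2 (state (dl a) (yn a) k).1.
  by apply: filterS yn_bound => a /(state_ball k)[].
have B_ k : \forall a \near Fl, B (state (dl a) (yn a) k).2.
  by apply: filterS yn_bound => a /(state_ball k)[].
elim: l => [|i l [xi_cvg x_cvg]].
  split; last exact: cvg_cst.
  by move=> e e0; apply: nearW => a h; rewrite subrr normr0 mulr_ge0// ltW.
have [sub_l B_l] := state_ball l (noise_bound0).
have [sub_il _] := state_ball (i :: l) (noise_bound0).
have xi'_cvg : dual_cvg Fl (fun a => (state (dl a) (yn a) (i :: l)).1)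
    (state (fun=> 0) y (i :: l)).1.
  move=> e e0; have e20 : 0 < e / 2 by rewrite divr_gt0.
  have := step_direction_cvg i (B_ l) B_l x_cvg e20.
  move: (xi_cvg _ e20); apply: filterS2 => a H1 H2 h.
  have -> : e * `|h| = e / 2 * `|h| + e / 2 * `|h| by field.
  apply: le_trans (lerD (H1 h) (H2 h)).
  have normBB (b c b' c' : R) : `|(b - c) - (b' - c')| <= `|b - b'| + `|c - c'|.
    have -> : b - c - (b' - c') = b - b' - (c - c') by ring.
    exact: ler_normB.
  exact: normBB.
split=> //; exact: cvg_subgradient (sub_ (i :: l)) sub_il xi'_cvg.
Qed.

End Stability.

(** * Summability of the weights in expectation *)

Section ExpectedTail.
Context {d : measure_display} {Omega : measurableType d} (P : probability Omega R)
  (ind : nat -> Omega -> 'I_N).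
Hypothesis iid : iid_uniform P ind.
Hypothesis N_gt0 : (0 < N)%N.
Variable xh : X.
Hypothesis xh_sol : ball_solution xh.

Let NR_gt0 : 0 < N%:R :> R. Proof. by rewrite ltr0n. Qed.

Let C := 3 * mu1 * (1 + eta).
Let C_ge0 : 0 <= C.
Proof. by rewrite !mulr_ge0 ?addr_ge0// ltW// (mu1_gt0 S). Qed.

Let Dl l := D (exact l).1 xh (exact l).2.

Let Dl_ge0 l : 0 <= Dl l.
Proof.
have [sub_l _] := state_ball l noise_bound0; have [_ _ exh] := xh_sol.
exact: (bregman_real_ge0 (theta_proper S) (sigma_gt0 S) (theta_bregman S) sub_l exh).
Qed.

(** [cauchy_weight] at [m] read off the word of [m + 1] indices, whose head is the index drawn at
    step [m]. *)
Let weight_list l := if l is _ :: l' then Dl l' - Dl l + C * residual l' else 0.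

Let c := c0 * Num.min (mu0 / B0 `^ p) mu1.

Let c_gt0 : 0 < c.
Proof.
rewrite mulr_gt0 ?(c0_gt0 S)// lt_min (mu1_gt0 S) andbT.
by rewrite divr_gt0 ?powR_gt0 ?(mu0_gt0 S) ?(B0_gt0 S).
Qed.

Let residual_decrease i l : c * `|F i (exact l).2 - y i| `^ p <= Dl l - Dl (i :: l).
Proof.
have [sub_l Bl] := state_ball l noise_bound0.
have := next_decrease i noise_bound0 sub_l Bl xh_sol.
have := exact_step_residual (F i (exact l).2 - y i) Bl.
move/(ler_wpM2l (ltW (c0_gt0 S))); rewrite mulrA -/c => H1 H2.
by rewrite lerBrDl; apply: le_trans H2; rewrite lerD2l.
Qed.

Let Dl_decrease i l : Dl (i :: l) <= Dl l.
Proof.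
rewrite -subr_ge0; apply: le_trans (residual_decrease i l).
by rewrite mulr_ge0 ?powR_ge0// ltW.
Qed.

Let weight_list_ge0 l : 0 <= weight_list l.
Proof.
case: l => [//|i l]; rewrite addr_ge0 ?subr_ge0//.
by rewrite mulr_ge0// residual_ge0.
Qed.

Let K := 1 + N%:R * C / c.

(** Here drawn residuals become total ones: each index [i] yields a decrease of [c] times its own
    residual, and summing over [i] gives [c * residual l]. The weights contain [N] copies of
    [C * residual l], hence the constant [K]. *)
Let weight_sum_le l :
  \sum_(i < N) weight_list (i :: l) <= K * \sum_(i < N) (Dl l - Dl (i :: l)).
Proof.
rewrite big_split/= mulrDl mul1r lerD2l sumr_const card_ord -[_ *+ N]mulr_natl.
have res_le : c * residual l <= \sum_(i < N) (Dl l - Dl (i :: l)).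
  by rewrite mulr_sumr; apply: ler_sum => i _; exact: residual_decrease.
rewrite [leRHS]mulrAC ler_pdivlMr//.
have -> : N%:R * (C * residual l) * c = N%:R * C * (c * residual l) by ring.
by rewrite ler_wpM2l// mulr_ge0.
Qed.

Let mean n (g : seq 'I_N -> R) := (N%:R^-1) ^+ n * \sum_(t : n.-tuple 'I_N) g t.

Let mean_weight_le n :
  mean n.+1 weight_list <= K * (mean n Dl - mean n.+1 Dl).
Proof.
have Nn : 0 <= (N%:R^-1) ^+ n.+1 :> R by rewrite exprn_ge0// invr_ge0.
rewrite /mean !big_tuple_cons.
apply: (@le_trans _ _ ((N%:R^-1) ^+ n.+1 *
   \sum_(t : n.-tuple 'I_N) K * \sum_(i < N) (Dl t - Dl (i :: t)))).
  by rewrite ler_wpM2l//; apply: ler_sum => t _; exact: weight_sum_le.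
rewrite -mulr_sumr mulrCA le_eqVlt; apply/orP; left; apply/eqP; congr (_ * _).
under eq_bigr do rewrite big_split/= sumr_const card_ord sumrN.
rewrite big_split/= sumrN mulrBr; congr (_ - _).
rewrite sumrMnl exprSr -mulrA -[X in _ * (_ * X)]mulr_natl mulKf//.
by rewrite gt_eqF.
Qed.

Let mean_weight_ge0 n : 0 <= mean n weight_list.
Proof. by rewrite mulr_ge0 ?exprn_ge0 ?invr_ge0// sumr_ge0. Qed.

Let measurable_weight m :
  measurable_fun setT (fun w => (cauchy_weight (ind^~ w) xh m)%:E).
Proof. exact: (measurable_fun_past iid m.+1 (EFin \o weight_list)). Qed.

Let weight_ge0 w m : (0 <= (cauchy_weight (ind^~ w) xh m)%:E)%E.
Proof. by rewrite lee_fin; exact: (weight_list_ge0 (past (ind^~ w) m.+1)). Qed.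

Lemma measurable_tail n :
  measurable_fun setT (fun w => (\sum_(n <= m <oo) (cauchy_weight (ind^~ w) xh m)%:E)%E).
Proof.
under eq_fun do rewrite -(nneseries_addn n (weight_ge0 _)).
exact: (ge0_emeasurable_sum (P := xpredT) (fun k w _ _ => weight_ge0 w (k + n)%N)
  (fun k _ => measurable_weight (k + n))).
Qed.

Lemma expected_tailE n : (\int[P]_w (\sum_(n <= m <oo) (cauchy_weight (ind^~ w) xh m)%:E) =
  \sum_(n <= m <oo) (mean m.+1 weight_list)%:E)%E.
Proof.
under eq_integral do rewrite -(nneseries_addn n (weight_ge0 _)).
rewrite (integral_nneseries _ measurableT
  (f := fun k w => (cauchy_weight (ind^~ w) xh (k + n)%N)%:E))//.
rewrite -(nneseries_addn n (f := fun m => (mean m.+1 weight_list)%:E)); last first.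
  by move=> i; rewrite lee_fin.
apply: eq_eseriesr => k _.
exact: (integral_past iid N_gt0 (k + n).+1 weight_list_ge0).
Qed.

(** The mean weights are dominated by a telescoping series, so their total is at most [K] times the
    initial Bregman distance. *)
Lemma expected_tail_cvg :
  (\int[P]_w (\sum_(n <= m <oo) (cauchy_weight (ind^~ w) xh m)%:E))%E @[n --> \oo] --> 0%E.
Proof.
under eq_fun do rewrite expected_tailE.
apply: nneseries_tail_cvg => [|k _]; last by rewrite lee_fin.
apply: (@le_lt_trans _ _ (K * mean 0 Dl)%:E); last by rewrite ltry.
apply: lime_le.
  by apply: is_cvg_nneseries => k _ _; rewrite lee_fin.
apply: nearW => n; rewrite sumEFin lee_fin.
have K0 : 0 <= K by rewrite addr_ge0// divr_ge0 ?(ltW c_gt0)// mulr_ge0.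
apply: (@le_trans _ _ (\sum_(0 <= m < n) K * (mean m Dl - mean m.+1 Dl))).
  by rewrite !big_nat; apply: ler_sum => m _; exact: mean_weight_le.
rewrite -mulr_sumr ler_wpM2l//.
have -> : \sum_(0 <= m < n) (mean m Dl - mean m.+1 Dl) = mean 0 Dl - mean n Dl.
  rewrite -[RHS]opprB -(telescope_sumr (mean^~ Dl))// -sumrN.
  by apply: eq_bigr => m _; rewrite opprB.
by rewrite gerBl mulr_ge0 ?exprn_ge0 ?invr_ge0// sumr_ge0.
Qed.

End ExpectedTail.

(** * The random limit *)

Section ExactLimit.
Context {d : measure_display} {Omega : measurableType d} (P : probability Omega R)
  (ind : nat -> Omega -> 'I_N).
Hypothesis iid : iid_uniform P ind.
Hypothesis N_gt0 : (0 < N)%N.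

Lemma exact_limit : exists (xstar : Omega -> X) (tail : nat -> Omega -> \bar R),
  [/\ borel_measurable xstar, forall w, ball_solution (xstar w),
    (forall n, measurable_fun setT (tail n)) /\ (forall n w, 0 <= tail n w)%E,
    (\int[P]_w (tail n w))%E @[n --> \oo] --> 0%E &
    (forall n w, ((D (exact (past (ind^~ w) n)).1 (xstar w)
                     (exact (past (ind^~ w) n)).2)%:E <= tail n w)%E) /\
    forall xd, bregman_minimal_solution domF F y theta xi0 x0 xd ->
      (forall i z, B z -> nullspace (dF i xd) `<=` nullspace (dF i z)) ->
      forall w, xstar w = xd].
Proof.
have [xs [xs_sol _ _]] := start_solution.
pose tail n w := (\sum_(n <= m <oo) (cauchy_weight (ind^~ w) xs m)%:E)%E.
(* Off [good], a null set, [tail] is infinite and bounds anything. *)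
pose good w := (tail 0%N w < +oo)%E.
pose special xd := bregman_minimal_solution domF F y theta xi0 x0 xd /\
   forall i z, B z -> nullspace (dF i xd) `<=` nullspace (dF i z).
(* The value of the limit off [good], chosen so that the identification with [xd] holds on every
   path and not only almost surely. *)
have [b [b_sol b_special]] : exists b, ball_solution b /\ ((exists xd, special xd) -> special b).
  have [[xd xdP]|no] := pselect (exists xd, special xd).
    by exists xd; split=> //; apply: minimal_solution_ball; exact: xdP.1.
  by exists xs; split=> // /no.
have goodP w : good w -> exists z, [/\ ball_solution z,
    (exact (past (ind^~ w) n)).2 @[n --> \oo] --> z &
    forall n, ((D (exact (past (ind^~ w) n)).1 z (exact (past (ind^~ w) n)).2)%:E <= tail n w)%E].
  exact: (exact_path_cvg xs_sol).
have weight_ge0 w m : (0 <= (cauchy_weight (ind^~ w) xs m)%:E)%E.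
  by rewrite lee_fin; exact: (cauchy_weight_ge0 _ xs_sol).
have [xstar xstarP] : {xstar : Omega -> X & forall w,
    (good w -> [/\ ball_solution (xstar w),
      (exact (past (ind^~ w) n)).2 @[n --> \oo] --> xstar w &
      forall n, ((D (exact (past (ind^~ w) n)).1 (xstar w) (exact (past (ind^~ w) n)).2)%:E
          <= tail n w)%E]) /\ (~ good w -> xstar w = b)}.
  apply: (@choice _ _ (fun w z => (good w -> [/\ ball_solution z,
      (exact (past (ind^~ w) n)).2 @[n --> \oo] --> z &
      forall n, ((D (exact (past (ind^~ w) n)).1 z (exact (past (ind^~ w) n)).2)%:E
          <= tail n w)%E]) /\ (~ good w -> z = b))) => w.
  by have [/[dup] gw /goodP[z zP]|gw] := pselect (good w); [exists z|exists b].
have tail_ge0 n w : (0 <= tail n w)%E by apply: nneseries_ge0.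
have mtail n : measurable_fun setT (tail n) by exact: (measurable_tail iid xs_sol n).
have tail_cvg := expected_tail_cvg iid N_gt0 xs_sol.
have special_good xd w : special xd -> good w -> xstar w = xd.
  move=> [xdmin null] gw; have [sol_w cvg_w D_w] := (xstarP w).1 gw.
  exact: (exact_path_minimal xs_sol gw xdmin null sol_w cvg_w D_w).
have tail_bad n w : ~ good w -> tail n w = +oo%E.
  rewrite /good /tail (nneseries_split 0 n)//= add0n sumEFin.
  move=> /negP; rewrite -leNgt leye_eq -/(tail n w).
  by case: (tail n w) (tail_ge0 n w).
(* If every path were bad, all expected tails would be infinite. One good path shows that any two
   special points agree, both being its limit. *)
have [w0 gw0] : exists w, good w.
  apply/not_existsP => nogood.
  have int_tail n : (\int[P]_w tail n w = +oo)%E.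
    under eq_integral do rewrite tail_bad//.
    by rewrite integral_cst// [X in (_ * X)%E]probability_setT mule1.
  have : (\int[P]_w tail n w)%E @[n --> \oo] --> +oo%E.
    by under eq_fun do rewrite int_tail; exact: cvg_cst.
  move=> inf_cvg; have := @lt0y R.
  by rewrite (cvg_unique (@ereal_hausdorff R) tail_cvg inf_cvg) ltxx.
exists xstar, tail; split=> //.
- apply: (@borel_measurable_cvg _ _ _ _ good (fun n w => (exact (past (ind^~ w) n)).2) _ b).
  + have := emeasurable_fun_infty_o measurableT (mtail 0%N) +oo%E.
    by rewrite setTI.
  + by move=> n A; exact: (measurable_past iid n [set l | A (exact l).2]).
  + by move=> w gw; have [] := (xstarP w).1 gw.
  + by move=> w; exact: (xstarP w).2.
- move=> w; have [gw|gw] := pselect (good w); first by have [] := (xstarP w).1 gw.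
  by rewrite ((xstarP w).2 gw).
- split=> [n w|xd xdmin null w].
    have [gw|gw] := pselect (good w); first by have [_ _] := (xstarP w).1 gw; apply.
    by rewrite (tail_bad n w gw) leey.
  have sp : special xd := conj xdmin null.
  have sb : special b := b_special (ex_intro _ xd sp).
  have [gw|gw] := pselect (good w); first exact: (special_good xd w sp gw).
  rewrite ((xstarP w).2 gw) -(special_good b w0 sb gw0).
  exact: (special_good xd w0 sp gw0).
Qed.

End ExactLimit.

(** * Transfer to noisy data *)

Section NoisyIterates.
Context {d : measure_display} {Omega : measurableType d} (P : probability Omega R)
  (ind : nat -> Omega -> 'I_N).
Hypothesis iid : iid_uniform P ind.
Hypothesis N_gt0 : (0 < N)%N.
Context (yd : ('I_N -> R) -> forall i, Y i)
  (xi : ('I_N -> R) -> Omega -> nat -> X -> R)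
  (x : ('I_N -> R) -> Omega -> nat -> X)
  (nstop : ('I_N -> R) -> nat).
Hypothesis data : forall delta, (forall i, 0 < delta i) ->
     (forall i, `|yd delta i - y i| <= delta i) /\
     (forall w, sgd_iterates F dF J theta p r mu0 mu1 tau x0 xi0 delta
                  (yd delta) (ind^~ w) (xi delta w) (x delta w)).
Hypothesis nstop_oo : nstop @ noise_to0 r --> \oo.

#[local] Instance noise_filter : Filter (@noise_to0 R N r) := noise_to0_filter r.

Let yd_bound : \forall delta \near @noise_to0 R N r, noise_bound delta (yd delta).
Proof. by apply: filterS (@noise_to0_gt0 R N r) => delta /data[]. Qed.

(** The noisy distance minus the exact one is minus a nonnegative Bregman distance plus the
    difference of the dual variables at a vector of norm at most [4 * rho], the diameter of the
    ball. Being one-sided, the bound avoids continuity of theta; being uniform in [xh], it applies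
    to the random limit. *)
Lemma noisy_bregman_near l e : 0 < e -> \forall delta \near @noise_to0 R N r,
  forall xh, B xh -> eff_dom theta xh ->
    D (state delta (yd delta) l).1 xh (state delta (yd delta) l).2 <=
    D (exact l).1 xh (exact l).2 + e.
Proof.
move=> e0; have rho0 := rho_gt0 S.
have rho4 : 0 < 4 * rho by rewrite mulr_gt0.
have e1 : 0 < e / (4 * rho) by rewrite divr_gt0.
have [xi_cvg _] := state_cvg yd_bound (fun i => noise_to0_cvg i r_gt0) l.
have [sub_l Bl] := state_ball l (noise_bound0).
move: (xi_cvg _ e1) yd_bound; apply: filterS2 => delta H nb xh Bxh exh.
have [sub_d Bd] := state_ball l nb.
have := bregman_real_ge0 (theta_proper S) (sigma_gt0 S) (theta_bregman S) sub_l sub_d.1.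
have dist : `|xh - (state delta (yd delta) l).2| <= 4 * rho.
  rewrite -(subrKA x0) (le_trans (ler_normD _ _))//.
  by move: Bxh Bd; rewrite /closed_ball_/= [`|x0 - xh|]distrC; lra.
have := le_trans (ler_norm _) (H ((state delta (yd delta) l).2 - xh)).
have : e / (4 * rho) * `|xh - (state delta (yd delta) l).2| <= e.
  by rewrite mulrAC ler_pdivrMr// ler_wpM2l// ltW.
have [_ [dl _]] := sub_l; have [_ [dd _]] := sub_d.
rewrite [`|_ - xh|]distrC /bregman_real !(dualB _ _ dl) !(dualB _ _ dd); lra.
Qed.

Lemma state_bregman_decreasing delta yn s n k xh : noise_bound delta yn ->
  ball_solution xh -> (n <= k)%N ->
  D (state delta yn (past s k)).1 xh (state delta yn (past s k)).2 <=
  D (state delta yn (past s n)).1 xh (state delta yn (past s n)).2.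
Proof.
move=> nb xh_sol /subnK <-; elim: (k - n)%N => [|m IH]; first by rewrite add0n.
rewrite addSn; apply: le_trans IH.
have [sub_m Bm] := state_ball (past s (m + n)) nb.
exact: (next_decreases (s (m + n)%N) nb sub_m Bm xh_sol).
Qed.

Lemma sgd_convergence : exists xstar : Omega -> X,
    [/\ borel_measurable xstar,
        forall w, [/\ solution domF F y (xstar w),
          closed_ball_ Num.norm x0 (2 * rho) (xstar w) & eff_dom theta (xstar w)],
        ('E_P[fun w => (`|x delta w (nstop delta) - xstar w| `^ p)%R])%E
          @[delta --> noise_to0 r] --> 0%E,
        (\int[P]_w bregman theta (xi delta w (nstop delta)) (xstar w)
                     (x delta w (nstop delta)))%E
          @[delta --> noise_to0 r] --> 0%E &
        forall xd, bregman_minimal_solution domF F y theta xi0 x0 xd ->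
          (forall i z, closed_ball_ Num.norm x0 (2 * rho) z ->
             nullspace (dF i xd) `<=` nullspace (dF i z)) ->
          forall w, xstar w = xd].
Proof.
have [xstar [tail [mx xsol [mtail tail_ge0] tail_cvg [D_tail xd_eq]]]] :=
  exact_limit iid N_gt0.
have sg0 := sigma_gt0 S.
pose Dn delta w := D (xi delta w (nstop delta)) (xstar w) (x delta w (nstop delta)).
(* Serves both limits: [c = sigma^-1] for the norm and [c = 1] for the Bregman distance. *)
have small (c e : R) : 0 <= c -> 0 < e -> \forall delta \near @noise_to0 R N r,
    forall f : Omega -> \bar R, (forall w, 0 <= f w <= (c * Dn delta w)%:E)%E ->
    (0 <= \int[P]_w f w <= e%:E)%E.
  (* One [e1] for the expected tail and one for the effect of noise; [c + 1] keeps the denominator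
     positive when [c = 0]. *)
  move=> c0 e0; pose e1 := e / (2 * (c + 1)).
  have e10 : 0 < e1 by rewrite divr_gt0// mulr_gt0// ltr_wpDl.
  have [n tail_n] : exists n, (\int[P]_w tail n w <= e1%:E)%E.
    have [fin_tail /cvgrPdist_le/(_ _ e10) tail_e] := (fine_cvgP _ _).1 tail_cvg.
    have [n [fn tn]] := filter_ex (filterI fin_tail tail_e).
    exists n; rewrite -(fineK fn) lee_fin.
    by move: tn; rewrite /= sub0r normrN; apply: le_trans; exact: ler_norm.
  (* The step [n] is fixed before the noise level, so only finitely many words have to be
     controlled. *)
  have uniform : \forall delta \near @noise_to0 R N r, forall t : n.-tuple 'I_N,
      forall xh, B xh -> eff_dom theta xh ->
      D (state delta (yd delta) t).1 xh (state delta (yd delta) t).2 <=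
      D (exact t).1 xh (exact t).2 + e1.
    exact: (filter_forall noise_filter (fun t : n.-tuple 'I_N => noisy_bregman_near t e10)).
  have stop_n : \forall delta \near @noise_to0 R N r, (n <= nstop delta)%N.
    exact: (nstop_oo (nbhs_infty_ge n)).
  near=> delta => f fP.
  have dp : forall i, 0 < delta i by near: delta; exact: noise_to0_gt0.
  have [nb iter] := data dp.
  have Dn_le w : ((Dn delta w)%:E <= tail n w + e1%:E)%E.
    have [solw Bw ew] := xsol w.
    apply: le_trans (leeD (D_tail n w) (lexx e1%:E)); rewrite -EFinD lee_fin.
    have stE := iterates_state nb (iter w).
    have -> : Dn delta w = D (state delta (yd delta) (past (ind^~ w) (nstop delta))).1
       (xstar w) (state delta (yd delta) (past (ind^~ w) (nstop delta))).2.
      by rewrite stE.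
    apply: (le_trans (state_bregman_decreasing (ind^~ w) nb (xsol w) (n := n) _)).
      by near: delta.
    have sz : size (past (ind^~ w) n) == n by rewrite size_past.
    have : forall t : n.-tuple 'I_N, forall xh, B xh -> eff_dom theta xh ->
      D (state delta (yd delta) t).1 xh (state delta (yd delta) t).2 <=
      D (exact t).1 xh (exact t).2 + e1 by near: delta.
    by move=> /(_ (Tuple sz) (xstar w) Bw ew).
  have f0 w : (0 <= f w)%E by have /andP[] := fP w.
  apply/andP; split; first exact: integral_ge0.
  apply: (@le_trans _ _ (\int[P]_w (c%:E * (tail n w + e1%:E)))%E).
    apply: ge0_le_integral_nonmeasurable => // w.
    have /andP[_ /le_trans] := fP w; apply; rewrite EFinM lee_wpmul2l ?lee_fin//.
  have e1_ge0 : (0 <= e1%:E)%E by rewrite lee_fin ltW.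
  rewrite ge0_integralZl_EFin//; last 2 first.
  - by move=> w _; rewrite adde_ge0.
  - by apply: emeasurable_funD; [exact: mtail|exact: measurable_cst].
  rewrite ge0_integralD//.
  have int_e1 : (\int[P]__ e1%:E = e1%:E)%E.
    by rewrite integral_cst// [X in (_ * X)%E]probability_setT mule1.
  rewrite int_e1.
  apply: (@le_trans _ _ (c%:E * (e1%:E + e1%:E))%E).
    by rewrite lee_wpmul2l ?lee_fin// leeD2r.
  rewrite -EFinD -EFinM lee_fin /e1.
  have -> : c * (e / (2 * (c + 1)) + e / (2 * (c + 1))) = e * (c / (c + 1)).
    by field; rewrite gt_eqF// ltr_wpDl.
  by rewrite ler_piMr// ?(ltW e0)// ler_pdivrMr ?ltr_wpDl// mul1r lerDl.
exists xstar; split => //.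
- apply: cvge0_squeeze => e e0.
  have sV0 : 0 <= sigma^-1 by rewrite invr_ge0 ltW.
  move: (small sigma^-1 e sV0 e0) (noise_to0_gt0 (N := N) r); apply: filterS2 => delta H dp.
  rewrite expectation.unlock; apply: H => w; rewrite !lee_fin powR_ge0/=.
  have [nb iter] := data dp.
  have [sub_st _] := state_ball (past (ind^~ w) (nstop delta)) nb.
  rewrite (iterates_state nb (iter w)) in sub_st.
  have [_ _ ew] := xsol w.
  rewrite ler_pdivlMl// distrC.
  exact: (bregman_real_ge (theta_proper S) (theta_bregman S) sub_st ew).
- apply: cvge0_squeeze => e e0.
  move: (small 1 e ler01 e0) (noise_to0_gt0 (N := N) r); apply: filterS2 => delta H dp.
  apply: H => w.
  have [nb iter] := data dp.
  have [sub_st _] := state_ball (past (ind^~ w) (nstop delta)) nb.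
  rewrite (iterates_state nb (iter w)) in sub_st.
  have [_ _ ew] := xsol w.
  rewrite (bregmanE (theta_proper S) _ ew sub_st.1) !lee_fin mul1r lexx andbT.
  exact: (bregman_real_ge0 (theta_proper S) sg0 (theta_bregman S) sub_st ew).
Unshelve. all: by end_near.
Qed.

End NoisyIterates.

End StochasticGradientDescent.

Theorem theorem3p7 (R : realType) (N : nat) (N_gt0 : (0 < N)%N)
  (X : completeNormedModType R) (Y : 'I_N -> completeNormedModType R)
  (domF : 'I_N -> set X) (F : forall i, X -> Y i) (dF : forall i, X -> X -> Y i)
  (y : forall i, Y i)
  (theta : X -> \bar R) (p r sigma rho eta B0 mu0 mu1 tau : R)
  (x0 : X) (xi0 : X -> R)
  (J : forall i, Y i -> Y i -> R)
  (d : measure_display) (Omega : measurableType d) (P : probability Omega R)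
  (ind : nat -> Omega -> 'I_N)
  (yd : ('I_N -> R) -> forall i, Y i)
  (xi : ('I_N -> R) -> Omega -> nat -> X -> R)
  (x : ('I_N -> R) -> Omega -> nat -> X)
  (nstop : ('I_N -> R) -> nat) :
  2 <= p -> proper_function theta -> lower_semicontinuous theta -> p_convex p theta ->
  0 < sigma ->
  (forall z x' zeta, dom_subdiff theta z -> subdiff theta z zeta ->
     ((sigma * `|x' - z| `^ p)%:E <= bregman theta zeta x' z)%E) ->
  dom_subdiff theta x0 -> subdiff theta x0 xi0 ->
  reflexive_space X -> (forall i, uniformly_smooth (Y i)) ->
  0 < rho -> closed_ball_ Num.norm x0 (2 * rho) `<=` common_dom domF ->
  (exists xs, [/\ solution domF F y xs, eff_dom theta xs &
     (bregman theta xi0 xs x0 <= (sigma * rho `^ p)%:E)%E]) ->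
  (forall i, weakly_closed F (common_dom domF) i) ->
  (forall i z, common_dom domF z ->
     frechet_within (common_dom domF) (F i) z (dF i z)) ->
  (forall i z, closed_ball_ Num.norm x0 (2 * rho) z ->
     opnorm (fun h => dF i z' h - dF i z h)
       @[z' --> within (closed_ball_ Num.norm x0 (2 * rho)) (nbhs z)]
       --> (0 : R)) ->
  0 < B0 ->
  (forall i z, closed_ball_ Num.norm x0 (2 * rho) z -> opnorm (dF i z) <= B0) ->
  0 <= eta < 1 ->
  (forall i z z', closed_ball_ Num.norm x0 (2 * rho) z ->
     closed_ball_ Num.norm x0 (2 * rho) z' ->
     `|F i z - F i z' - dF i z' (z - z')| <= eta * `|F i z - F i z'|) ->
  1 < r -> (forall i v, duality_mapping r v (J i v)) ->
  iid_uniform P ind ->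
  0 < mu0 -> 0 < mu1 -> 1 < tau ->
  0 < 1 - eta - (1 + eta) / tau
      - (p - 1) / p * (mu0 / (2 * sigma)) `^ (p - 1)^-1 ->
  (forall delta, (forall i, 0 < delta i) ->
     (forall i, `|yd delta i - y i| <= delta i) /\
     (forall w, sgd_iterates F dF J theta p r mu0 mu1 tau x0 xi0 delta
                  (yd delta) (ind^~ w) (xi delta w) (x delta w))) ->
  nstop @ noise_to0 r --> \oo ->
  (* The limit depends on the drawn indices in general, so the solution is a
     random variable; it is the constant xd under the null space condition. *)
  exists xstar : Omega -> X,
    [/\ borel_measurable xstar,
        forall w, [/\ solution domF F y (xstar w),
          closed_ball_ Num.norm x0 (2 * rho) (xstar w) & eff_dom theta (xstar w)],
        ('E_P[fun w => (`|x delta w (nstop delta) - xstar w| `^ p)%R])%E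
          @[delta --> noise_to0 r] --> 0%E,
        (\int[P]_w bregman theta (xi delta w (nstop delta)) (xstar w)
                     (x delta w (nstop delta)))%E
          @[delta --> noise_to0 r] --> 0%E &
        forall xd, bregman_minimal_solution domF F y theta xi0 x0 xd ->
          (forall i z, closed_ball_ Num.norm x0 (2 * rho) z ->
             nullspace (dF i xd) `<=` nullspace (dF i z)) ->
          forall w, xstar w = xd].
Proof.
move=> p2 pr lsc cvx sg0 breg dom0 sub0 _ smY rho0 ball sol0 _ fre dFc B00 dFb eta01
  tcc r1 Jd iid mu00 mu10 tau1 c0 data nstop_oo.
have S : sgd_setting domF F dF y theta p r sigma rho eta B0 mu0 mu1 tau x0 xi0 J.
  by split=> //; split=> //; exact: dom0.1.
exact: (sgd_convergence S iid N_gt0 data nstop_oo).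
Qed.
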